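(* Let $X$ be an infinite-dimensional complex Banach space, $\lambda\in\mathbb{C}$, $T\in L(X)$, $d\in\mathbb{N}_0$, and let $T-\lambda I$ have TUD for $n\ge d$. Then the following statements are equivalent: (1) $\sigma_{\mathcal{W}_+}(T)$ does not cluster at $\lambda$; (2) $\lambda$ is not an interior point of $\sigma_{\mathcal{W}_+}(T)$; (3) $\sigma_{B\mathcal{W}_+}(T)$ does not cluster at $\lambda$; (4) $\lambda$ is not an interior point of $\sigma_{B\mathcal{W}_+}(T)$; (5) $T-\lambda I$ is an upper semi-B-Weyl operator.
   Context: $L(X)$ is the algebra of bounded linear operators on $X$; $N(T)$, $R(T)$ are the null space and range; $\alpha(T)=\dim N(T)$, $\beta(T)=\operatorname{codim}R(T)$; $\mathbb{N}_0=\{0,1,2,\dots\}$. An operator $S$ on a complex Banach space is upper semi-Fredholm if $\alpha(S)<\infty$ and $R(S)$ is closed; its index is $\operatorname{ind}(S)=\alpha(S)-\beta(S)$; it is upper semi-Weyl if moreover $\operatorname{ind}(S)\le0$. $\sigma_{\mathcal{W}_+}(T)$ is the set of $\mu\in\mathbb{C}$ such that $T-\mu I$ is not upper semi-Weyl. For $n\in\mathbb{N}_0$ let $T_n$ be the restriction of $T$ to $R(T^n)$ as a map $R(T^n)\to R(T^n)$. $T$ is upper semi-B-Fredholm if for some $n\in\mathbb{N}_0$, $R(T^n)$ is closed and $T_n$ is upper semi-Fredholm; then $\operatorname{ind}(T):=\operatorname{ind}(T_n)$, which is independent of the choice of such $n$. $T$ is upper semi-B-Weyl if it is upper semi-B-Fredholm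 and $\operatorname{ind}(T)\le 0$. $\sigma_{B\mathcal{W}_+}(T)$ is the set of $\mu\in\mathbb{C}$ such that $T-\mu I$ is not upper semi-B-Weyl. Let $k_n(T)=\dim (R(T^n)\cap N(T))/(R(T^{n+1})\cap N(T))$. The operator range topology on $R(T^d)$ is given by the norm $\|y\|_d=\inf\{\|x\|:x\in X,\ y=T^dx\}$. $T$ has topological uniform descent (TUD) for $n\ge d$ if $k_n(T)=0$ for all $n\ge d$ and $R(T^n)$ is closed in the operator range topology of $R(T^d)$ for all $n\ge d$. A set $K\subset\mathbb{C}$ does not cluster at $\lambda$ if $\lambda$ is not an accumulation point of $K$; interior is taken in $\mathbb{C}$. *)

(* Defs.v *)
From HB Require Import structures.
From mathcomp Require Import all_boot all_order all_algebra.
From mathcomp Require Import complex.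
From mathcomp Require Import boolp classical_sets functions reals ereal.
From mathcomp Require Import topology normedtype.

Set Implicit Arguments.
Unset Strict Implicit.
Unset Printing Implicit Defensive.

Import Order.TTheory GRing.Theory Num.Theory.
Import numFieldNormedType.Exports.

Local Open Scope classical_set_scope.
Local Open Scope ring_scope.

Section Dimension.
Context (K : fieldType) (V : lmodType K).
Implicit Types A B : set V.

(* The cosets of e_0, ..., e_(n-1) form a basis of A / B, for linear subspaces
   B `<=` A. *)
Definition quot_basis A B (n : nat) (e : 'I_n -> V) : Prop :=
  [/\ forall i, A (e i),
      forall c : 'I_n -> K, B (\sum_i c i *: e i) -> forall i, c i = 0
    & forall x, A x -> exists c : 'I_n -> K, B (x - \sum_i c i *: e i)].

(* dim (A / B) in N u {+oo}, valued in \bar int so that indices, which may be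
   -oo, can be formed by subtraction. *)
Definition quot_dim A B : \bar int :=
  xget +oo%E [set m : \bar int | exists n, m = (n%:Z)%:E /\
    exists e : 'I_n -> V, quot_basis A B e].

Definition vdim A : \bar int := quot_dim A [set 0].

End Dimension.

Section Operators.
Context (R : realType) (X : normedModType R[i]).
Implicit Types (S T : {linear X -> X}) (M : set X) (n d : nat).

Definition null_space S : set X := [set x | S x = 0].

Definition range_pow T n : set X := range (iter n T).

(* For a linear subspace M with S(M) `<=` M, the notions suffixed with _on are
   those of the restriction S|M : M -> M; closedness of the range is relative
   to M. *)
Definition alpha_on M S : \bar int := vdim (M `&` null_space S).

Definition beta_on M S : \bar int := quot_dim M (S @` M).

Definition upper_semi_Fredholm_on M S : Prop :=
  (alpha_on M S < +oo)%E /\ closed (S @` M : set (subspace M)).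

Definition ind_on M S : \bar int := (alpha_on M S - beta_on M S)%E.

Definition upper_semi_Weyl S : Prop :=
  upper_semi_Fredholm_on setT S /\ (ind_on setT S <= 0)%E.

Definition B_Fredholm_at T n : Prop :=
  closed (range_pow T n) /\ upper_semi_Fredholm_on (range_pow T n) T.

Definition upper_semi_B_Fredholm T : Prop := exists n, B_Fredholm_at T n.

(* The index of T restricted to R(T^n), for a chosen n as in
   upper_semi_B_Fredholm; it does not depend on the choice. *)
Definition B_ind T : \bar int :=
  ind_on (range_pow T (xget 0%N [set n | B_Fredholm_at T n])) T.

Definition upper_semi_B_Weyl T : Prop :=
  upper_semi_B_Fredholm T /\ (B_ind T <= 0)%E.

Definition shift_op T (mu : R[i]) : {linear X -> X} := T \- mu \*: idfun.

Definition spectrum_W T : set (R[i] : numFieldType) :=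
  [set mu | ~ upper_semi_Weyl (shift_op T mu)].

Definition spectrum_BW T : set (R[i] : numFieldType) :=
  [set mu | ~ upper_semi_B_Weyl (shift_op T mu)].

Definition desc_k T n : \bar int :=
  quot_dim (range_pow T n `&` null_space T) (range_pow T n.+1 `&` null_space T).

(* The norm of X takes its values in R[i]; Re gives the same number in R. *)
Definition oprange_norm T d (y : X) : R :=
  inf [set complex.Re `|x| | x in [set x | y = iter d T x]].

Definition oprange_open T d (U : set X) : Prop :=
  U `<=` range_pow T d /\
  forall y, U y -> exists2 e : R, 0 < e &
    forall z, range_pow T d z -> oprange_norm T d (z - y) < e -> U z.

Definition oprange_closed T d (F : set X) : Prop :=
  F `<=` range_pow T d /\ oprange_open T d (range_pow T d `\` F).

Definition TUD T d : Prop :=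
  (forall n, (d <= n)%N -> desc_k T n = 0%E) /\
  (forall n, (d <= n)%N -> oprange_closed T d (range_pow T n)).

End Operators.

(* Main.v *)
From HB Require Import structures.
Require Import Defs.
From mathcomp Require Import all_boot all_order all_algebra.
From mathcomp Require Import complex.
From mathcomp Require Import boolp classical_sets functions reals ereal.
From mathcomp Require Import topology normedtype.
From mathcomp Require Import ring lra.
Import Order.TTheory GRing.Theory Num.Theory.
Import numFieldNormedType.Exports.
Local Open Scope classical_set_scope.
Local Open Scope ring_scope.

(** Write [S] for [T - lambda], [M] for the null space of [S^d], and call
    alpha_n, beta_n the nullity and the defect of the restriction of [S] to
    [R(S^n)]. The five statements are equivalent because of a punctured
    neighbourhood theorem, [punctured_neighbourhood]: under topological uniform
    descent for [n >= d] there is a radius [r > 0] such that for every [v] with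
    [0 < |v| <= r] the operator [S - v] has closed range, its null space lies in
    all the ranges [R((S - v)^n)], its nullity is alpha_d, and its defect is
    beta_d. So, on the whole punctured disk, being upper semi-Weyl and being
    upper semi-B-Weyl are one and the same condition: alpha_d is finite and
    alpha_d <= beta_d. Restricting from [R(S^n)] to [R(S^(n+1))] lowers nullity
    and defect by the same number [k_n(S)], so, as long as the nullities are
    finite, the inequality between them does not depend on [n]
    ([alpha_le_beta_leq]); together with the closedness of [R(S^n)] for [n >= d]
    when alpha_d is finite ([closed_range]) this shows that the same condition
    characterizes the upper semi-B-Weyl operators among the [S] at hand. Hence
    either both spectra miss a whole punctured neighbourhood of [lambda] and
    [S] is upper semi-B-Weyl, or both contain a neighbourhood of [lambda].

    The usual proof of the punctured neighbourhood theorem passes to the Banach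
    space [R(S^d)], isomorphic to [X / M], on which [S] has closed range and a
    null space contained in all the ranges of its powers. Here the argument
    stays inside [X] and works modulo [M]. Let [H] be the set of the [x] with
    [S^d x] in all the [R(S^n)]. It is a closed subspace containing [M]; [S]
    maps [H] onto [H] modulo [M], and it induces on [X / H] an injective
    operator with closed range. The open mapping theorem provides constants for
    both facts, and those survive when [S] is replaced by [S - v] with [v] small
    ([core_lift], [core_dist]). Consequently the two families
    [K_v = (S - v)^-1(M)], contained in [H], and [R_v = R(S - v) + H] move, in
    the sense of gaps between subspaces, at a bounded speed in [v].

    A small gap preserves dimensions: by Riesz's lemma, [m] vectors independent
    modulo a closed subspace can be chosen so well separated that they stay
    independent after a perturbation of a size depending only on [m]
    ([indep_perturb_numerator], [indep_perturb_denominator]). This threshold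
    shrinks as [m] grows, but the disk need not: one goes from [0] to [v] in
    steps that are short enough for [m] ([disk_chain]). So the dimension of
    [K_v / M] and the codimension of [R_v] are constant, even if infinite. At
    [v = 0] they are alpha_d and beta_d; for [v <> 0] they are the nullity and
    the defect of [S - v], because [S - v] is invertible on [M]. *)
Set Implicit Arguments.
Unset Strict Implicit.
Unset Printing Implicit Defensive.

(** * Dimensions of quotients of subspaces *)
Section LinearAlgebra.
Context (K : fieldType).

Definition linsub (V : lmodType K) (A : set V) : Prop :=
  A 0 /\ forall a x y, A x -> A y -> A (a *: x + y).

(** Dimensions are compared through the predicates [indep A B n]: they decide
    [quot_dim A B] even when it is infinite ([quot_dimP]), and they behave well
    under linear maps and perturbations. *)
Definition indep (V : lmodType K) (A B : set V) (n : nat) : Prop :=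
  exists e : 'I_n -> V, (forall i, A (e i)) /\
    forall c : 'I_n -> K, B (\sum_i c i *: e i) -> forall i, c i = 0.

Section OneSpace.
Context (V : lmodType K).
Implicit Types A B C : set V.

Lemma linsub0 A : linsub A -> A 0. Proof. by case. Qed.

Lemma linsubZ A : linsub A -> forall a x, A x -> A (a *: x).
Proof. by move=> [A0 AL] a x Ax; rewrite -[_ *: _]addr0; exact: AL. Qed.

Lemma linsubD A : linsub A -> forall x y, A x -> A y -> A (x + y).
Proof. by move=> [A0 AL] x y Ax Ay; rewrite -[x]scale1r; exact: AL. Qed.

Lemma linsubN A : linsub A -> forall x, A x -> A (- x).
Proof. by move=> lA x Ax; rewrite -scaleN1r; exact: linsubZ. Qed.

Lemma linsubB A : linsub A -> forall x y, A x -> A y -> A (x - y).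
Proof. by move=> lA x y Ax Ay; apply: linsubD => //; exact: linsubN. Qed.

Lemma linsub_sum A (I : finType) (f : I -> V) :
  linsub A -> (forall i, A (f i)) -> A (\sum_i f i).
Proof.
move=> lA Af; elim/big_ind: _ => //; first exact: linsub0.
exact: linsubD.
Qed.

Lemma linsub_comb A n (c : 'I_n -> K) (e : 'I_n -> V) :
  linsub A -> (forall i, A (e i)) -> A (\sum_i c i *: e i).
Proof. by move=> lA Ae; apply: linsub_sum => // i; exact: linsubZ. Qed.

Lemma linsubBr A x y : linsub A -> A (x - y) -> A x -> A y.
Proof. by move=> lA Axy Ax; rewrite -(subKr x y); apply: linsubB. Qed.

Lemma linsubBl A x y : linsub A -> A (x - y) -> A y -> A x.
Proof. by move=> lA Axy Ay; rewrite -(subrK y x); apply: linsubD. Qed.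

Lemma linsubT : linsub [set: V]. Proof. by []. Qed.

Lemma linsub_0 : linsub [set (0 : V)].
Proof. by split=> // a x y -> ->; rewrite scaler0 addr0. Qed.

Lemma linsubI A B : linsub A -> linsub B -> linsub (A `&` B).
Proof.
move=> [A0 AL] [B0 BL]; split=> // a x y [Ax Bx] [Ay By].
by split; [exact: AL | exact: BL].
Qed.

(** The coordinates of [m] vectors modulo [B] form an [m * n] matrix, which has
    a nonzero left kernel if [n < m]. *)
Lemma steinitz A B n m (e : 'I_n -> V) :
  linsub B -> quot_basis A B e -> indep A B m -> (m <= n)%N.
Proof.
move=> lB [_ _ span] [f [Af indf]].
have /choice[M MP] : forall j : 'I_m, exists c : 'I_n -> K,
    B (f j - \sum_i c i *: e i) by move=> j; exact: span.
pose N := \matrix_(j < m, i < n) M j i.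
rewrite leqNgt; apply/negP => nm.
have : kermx N != 0.
  rewrite -mxrank_eq0 mxrank_ker subn_eq0 -ltnNge.
  by rewrite (leq_ltn_trans (rank_leq_col _)).
case/rowV0Pn => u /sub_kermxP uN /negP[].
have : B (\sum_j u ord0 j *: f j).
  have -> : \sum_j u ord0 j *: f j =
      \sum_j u ord0 j *: (f j - \sum_i M j i *: e i).
    apply/eqP; rewrite -subr_eq0 -sumrB.
    under eq_bigr do rewrite -scalerBr opprB addrCA subrr addr0 scaler_sumr.
    rewrite exchange_big big1// => i _.
    under eq_bigr do rewrite scalerA.
    have uN0 : \sum_j u ord0 j * M j i = 0.
      have /matrixP/(_ ord0 i) := uN; rewrite mxE [RHS]mxE => {2}<-.
      by apply: eq_bigr => j _; rewrite [N _ _]mxE.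
    by rewrite -scaler_suml uN0 scale0r.
  exact: linsub_comb.
move/indf => u0; apply/eqP/rowP => j.
by rewrite mxE.
Qed.

Lemma indep0 A B : indep A B 0.
Proof. by exists (fun=> 0); split => [[]|c _ []]. Qed.

Lemma indepS A B n : linsub B -> indep A B n.+1 -> indep A B n.
Proof.
move=> lB [e [Ae inde]]; exists (fun i => e (lift ord0 i)); split=> // c Bc i.
pose c' j := if unlift ord0 j is Some k then c k else 0.
have -> : c i = c' (lift ord0 i) by rewrite /c' liftK.
apply: inde; rewrite big_ord_recl /c' unlift_none scale0r add0r.
by under eq_bigr do rewrite liftK.
Qed.

Lemma indep_leq A B m n : linsub B -> (m <= n)%N -> indep A B n -> indep A B m.
Proof.
move=> lB; elim: n => [|n IH]; first by rewrite leqn0 => /eqP->.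
by rewrite leq_eqVlt => /predU1P[-> //|mn] /(indepS lB)/IH; apply.
Qed.

(** A maximal independent family spans: otherwise it could be extended. *)
Lemma indep_maximal_basis A B n : linsub B ->
  indep A B n -> ~ indep A B n.+1 -> exists e : 'I_n -> V, quot_basis A B e.
Proof.
move=> lB [e [Ae inde]] nind; exists e; split=> // x Ax.
apply: contrapT => xnot; apply: nind.
exists (fun i => if unlift ord0 i is Some j then e j else x); split.
  by move=> i; case: unliftP.
move=> c; rewrite big_ord_recl unlift_none.
under eq_bigr do rewrite liftK.
move=> Bc; have c0 : c ord0 = 0.
  apply: contra_notP xnot => /eqP c0.
  exists (fun i => - (c ord0)^-1 * c (lift ord0 i)).
  have := linsubZ lB (c ord0)^-1 Bc.
  rewrite scalerDr scalerA mulVf// scale1r scaler_sumr -sumrN.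
  congr (B (_ + _)); apply: eq_bigr => i _.
  by rewrite scalerA mulNr scaleNr opprK.
move: Bc; rewrite c0 scale0r add0r => /inde ci0 i.
by case: (unliftP ord0 i) => [j ->|->].
Qed.

(** The infinite case states that there are arbitrarily large independent
    families, which is stronger than the absence of a finite basis. *)
Variant quot_dim_spec A B : \bar int -> Prop :=
| QuotDimFin n e of quot_basis A B (e : 'I_n -> V) &
    (forall m, indep A B m <-> (m <= n)%N) : quot_dim_spec A B (n%:Z)%:E
| QuotDimInf of (forall m, indep A B m) : quot_dim_spec A B +oo%E.

Lemma quot_dimP A B : linsub B -> quot_dim_spec A B (quot_dim A B).
Proof.
move=> lB; rewrite /quot_dim; case: xgetP => [_ _ [n [-> [e eb]]]|noP].
  apply: (QuotDimFin eb) => m; split; first exact: steinitz eb.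
  move=> /indep_leq; apply=> //; exists e.
  by case: eb.
apply: QuotDimInf => m; elim: m => [|m IH]; first exact: indep0.
apply: contrapT => /(indep_maximal_basis lB IH) [e eb].
by apply: (noP (m%:Z)%:E); exists m; split => //; exists e.
Qed.

Lemma quot_dim_lty A B n : linsub B ->
  ~ indep A B n -> (quot_dim A B < +oo)%E.
Proof. by move=> lB; case: quot_dimP => // [m e eb _|/(_ n)//]; rewrite ltry. Qed.

Lemma quot_dim_eq0 A B : linsub B -> quot_dim A B = 0%E -> A `<=` B.
Proof.
move=> lB; case: quot_dimP => // n e [_ _ span] _ [] n0 x /span.
by move: e span n0; case: n => // e span _ [c]; rewrite big_ord0 subr0.
Qed.

End OneSpace.

Lemma quot_dim_le (V W : lmodType K) (A B : set V) (A' B' : set W) :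
  linsub B -> linsub B' -> (forall n, indep A B n -> indep A' B' n) ->
  (quot_dim A B <= quot_dim A' B')%E.
Proof.
move=> lB lB' AA'; case: (quot_dimP A' lB') => [n e eb indA'|]; last first.
  by move=> _; rewrite leey.
case: quot_dimP => // [m f fb indA|indA].
  by rewrite lee_fin lez_nat; apply/indA'/AA'/indA.
by have /AA'/indA' := indA n.+1; rewrite ltnn.
Qed.

Lemma quot_dim_eq (V W : lmodType K) (A B : set V) (A' B' : set W) :
  linsub B -> linsub B' -> (forall n, indep A B n <-> indep A' B' n) ->
  quot_dim A B = quot_dim A' B'.
Proof.
by move=> lB lB' AA'; apply/eqP; rewrite eq_le; apply/andP; split;
  apply: quot_dim_le => // n /AA'.
Qed.

Section Transfer.
Context (V W : lmodType K) (phi : {linear V -> W}).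
Context (A B : set V) (A' B' : set W).
Hypotheses (lA : linsub A) (lB' : linsub B').

Lemma indep_image n : (forall x, A x -> A' (phi x)) ->
  (forall x, A x -> B' (phi x) -> B x) -> indep A B n -> indep A' B' n.
Proof.
move=> AA' BB' [e [Ae inde]]; exists (phi \o e); split=> [i|c]; first exact: AA'.
move=> cB; apply: inde; apply: BB'; first exact: linsub_comb.
by rewrite linear_sum; under eq_bigr do rewrite linearZ.
Qed.

Lemma indep_preimage n : (forall y, A' y -> exists2 x, A x & B' (y - phi x)) ->
  (forall x, B x -> B' (phi x)) -> indep A' B' n -> indep A B n.
Proof.
move=> AA' BB' [e [Ae inde]].
have /choice[f fP] : forall i, exists x, A x /\ B' (e i - phi x).
  by move=> i; case: (AA' _ (Ae i)) => x; exists x.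
exists f; split=> [i|c /BB' Bc]; first by case: (fP i).
apply: inde; apply: linsubBl Bc => //; rewrite linear_sum -sumrB.
apply: linsub_sum => // i; rewrite linearZ -scalerBr; apply: linsubZ => //.
by case: (fP i).
Qed.

(** The assumptions say that [phi] induces an isomorphism of [A / B] onto
    [A' / B']; both quotients may be infinite-dimensional. *)
Lemma quot_dim_iso : linsub B -> (forall x, A x -> A' (phi x)) ->
  (forall y, A' y -> exists2 x, A x & B' (y - phi x)) ->
  B `<=` A -> (forall x, A x -> B x <-> B' (phi x)) ->
  quot_dim A B = quot_dim A' B'.
Proof.
move=> lB AA' A'A BA BB'; apply: quot_dim_eq => // n; split.
  by apply: indep_image => // x /BB'[].
by apply: indep_preimage => // x Bx; apply/BB' => //; exact: BA.
Qed.

End Transfer.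

Lemma quot_dimD (V : lmodType K) (A B C : set V) :
  linsub A -> linsub B -> linsub C -> B `<=` A -> C `<=` B ->
  quot_dim A C = (quot_dim A B + quot_dim B C)%E.
Proof.
move=> lA lB lC BA CB.
have sAB n : indep A B n -> indep A C n.
  by apply: (indep_image (phi := idfun)) => // x _ /CB.
have sBC n : indep B C n -> indep A C n.
  by apply: (indep_image (phi := idfun)) => // x /BA.
case: (quot_dimP A lB) => [n e eb _|iAB]; last first.
  have -> : quot_dim A C = +oo%E.
    case: quot_dimP => // m _ _ indA.
    by have /sAB/indA := iAB m.+1; rewrite ltnn.
  by case: quot_dimP.
case: (quot_dimP B lC) => [m f fb _|iBC]; last first.
  case: quot_dimP => // p _ _ indA.
  by have /sBC/indA := iBC p.+1; rewrite ltnn.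
case: eb fb => Ae inde spane [Bf indf spanf].
pose g (i : 'I_(n + m)) :=
  match fintype.split i with inl j => e j | inr k => f k end.
have sumg (c : 'I_(n + m) -> K) : \sum_i c i *: g i =
    \sum_i c (lshift m i) *: e i + \sum_i c (rshift n i) *: f i.
  rewrite big_split_ord; congr (_ + _); apply: eq_bigr => i _; rewrite /g.
    by rewrite -[lshift m i]/(unsplit (inl i)) unsplitK.
  by rewrite -[rshift n i]/(unsplit (inr i)) unsplitK.
have gb : quot_basis A C g; first split.
- by move=> i; rewrite /g; case: fintype.split => // j; apply: BA.
- move=> c; rewrite sumg => Cc.
  have ce i : c (lshift m i) = 0.
    apply: (inde (fun i => c (lshift m i))).
    apply: (linsubBl (y := - \sum_i c (rshift n i) *: f i)) => //.
      by rewrite opprK; exact: CB.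
    by apply: linsubN => //; exact: linsub_comb.
  move: Cc; under eq_bigr do rewrite ce scale0r.
  rewrite big1// add0r => /(indf (fun i => c (rshift n i))) cf i.
  by rewrite -(fintype.splitK i); case: fintype.split => j /=.
- move=> x /spane[c Bc]; have [c' Cc'] := spanf _ Bc.
  exists (fun i : 'I_(n + m) =>
    match fintype.split i with inl j => c j | inr k => c' k end).
  rewrite sumg opprD addrA; congr (C (_ - _ - _)): Cc'; apply: eq_bigr => i _.
    by rewrite -[lshift m i]/(unsplit (inl i)) unsplitK.
  by rewrite -[rshift n i]/(unsplit (inr i)) unsplitK.
case: (quot_dimP A lC) => [p h hb indA|indA].
  rewrite -EFinD -PoszD; congr ((Posz _)%:E); apply/eqP; rewrite eqn_leq.
  have iAC : indep A C (n + m) by exists g; case: gb.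
  rewrite (indA (n + m)%N).1 // andbT; apply: (steinitz lC gb).
  by exists h; case: hb.
by have := steinitz lC gb (indA (n + m).+1); rewrite ltnn.
Qed.

(** The sum [f(D) + M], written so that membership of [z] exhibits a preimage of [z]
    modulo [M]; all uses of the open mapping theorem concern
    such sums. *)
Section ImagePlus.
Context (V : lmodType K) (f : {linear V -> V}) (D M : set V).
Context (lD : linsub D) (lM : linsub M).
Implicit Types x y z m : V.

Definition image_plus : set V := [set z | exists2 x, D x & M (z - f x)].

Lemma linsub_image_plus : linsub image_plus.
Proof.
split; first by exists 0; [exact: linsub0|rewrite linear0 subr0; exact: linsub0].
move=> a y z [x Dx My] [x' Dx' Mz]; exists (a *: x + x'); first exact: lD.2.
by rewrite linearP opprD addrACA -scalerBr; exact: lM.2.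
Qed.

Lemma image_plus_l x : D x -> image_plus (f x).
Proof. by move=> Dx; exists x => //; rewrite subrr; exact: linsub0. Qed.

Lemma image_plus_r m : M m -> image_plus m.
Proof. by exists 0; [exact: linsub0|rewrite linear0 subr0]. Qed.

Lemma image_plusB z x : D x -> image_plus z -> image_plus (z - f x).
Proof.
by move=> Dx Zz; apply: linsubB => //; [exact: linsub_image_plus|exact: image_plus_l].
Qed.

End ImagePlus.

End LinearAlgebra.

(** * The norm as a real number, and completeness *)
Lemma geometric_small (R : realType) (a e : R) :
  0 < e -> exists n, a * 2^-1 ^+ n < e.
Proof.
move=> e0; have [a0|a0] := leP a 0.
  by exists 0; rewrite expr0 mulr1; exact: le_lt_trans e0.
exists (Num.bound (a / e)); have ae0 : 0 <= a / e by rewrite ltW// divr_gt0.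
have := archi_boundP ae0; rewrite ltr_pdivrMr// => h.
rewrite exprVn ltr_pdivrMr ?exprn_gt0// mulrC (lt_trans h)// ltr_pM2r//.
by rewrite -natrX ltr_nat ltn_expl.
Qed.

(** The hypothesis says that the ball of radius [r k.+1] around [u k.+1] lies in
    the ball of radius [r k] around [u k]; the limit is their common point. *)
Lemma nested_balls_complete (K : numFieldType) (X : completeNormedModType K)
    (u : nat -> X) (r : nat -> K) :
  (forall k, `|u k.+1 - u k| <= r k - r k.+1) -> (forall k, 0 <= r k) ->
  (forall e, 0 < e -> exists k, r k < e) ->
  exists l, forall k, `|l - u k| <= r k.
Proof.
move=> ur r0 rsmall.
have tele k j : `|u (k + j)%N - u k| <= r k - r (k + j)%N.
  elim: j => [|j IH]; first by rewrite addn0 !subrr normr0.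
  rewrite addnS -(subrKA (u (k + j)%N)) (le_trans (ler_normD _ _))//.
  by rewrite -[leRHS](subrKA (r (k + j)%N)) [leRHS]addrC lerD// ur.
have tail k j : (k <= j)%N -> `|u j - u k| <= r k.
  by move=> /subnKC <-; rewrite (le_trans (tele _ _))// gerBl.
have /cauchy_cvg cu : cauchy (u @ \oo).
  apply/cauchy_exP => e e0; have [k rk] := rsmall e e0.
  exists (u k); exists k => // j /= kj.
  by rewrite -ball_normE/= distrC (le_lt_trans (tail _ _ kj)).
exists (lim (u @ \oo)) => k; apply/ler_addgt0Pr => e e0.
have /cvgrPdist_lt/(_ e e0)[N _ uN] := cu.
have := uN (maxn N k) (leq_maxl _ _) => /= d1.
rewrite -(subrKA (u (maxn N k))) (le_trans (ler_normD _ _))// addrC.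
by rewrite lerD ?tail ?leq_maxr// ltW.
Qed.

Notation cabs := Normc.normc.

Section RealNorm.
Context (R : realType).

Lemma cabsE (a : R[i]) : `|a| = (cabs a)%:C%C. Proof. by case: a. Qed.

Lemma cabs_ge0 (a : R[i]) : 0 <= cabs a.
Proof. by rewrite -ler0c -cabsE. Qed.

Lemma cabs_real (r : R) : cabs r%:C%C = `|r|.
Proof. by rewrite /= expr0n addr0 sqrtr_sqr. Qed.

Lemma cabs_eq0 (a : R[i]) : (cabs a == 0) = (a == 0).
Proof.
by apply/eqP/eqP => [/Normc.eq0_normc//|->]; rewrite (Normc.normc0 R).
Qed.

Lemma cabs_gt0 (a : R[i]) : (0 < cabs a) = (a != 0).
Proof. by rewrite lt0r cabs_ge0 andbT cabs_eq0. Qed.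

Lemma cabs_dist (a b : R[i]) : cabs (a - b) = cabs (b - a).
Proof. by rewrite -normcN opprB. Qed.

Section Basics.
Context (X : normedModType R[i]).
Implicit Types x y z : X.

(** The norm of [X] has values in [R[i]]; [nrm] is the same norm with values
    in the totally ordered field [R]. *)
Definition nrm (x : X) : R := complex.Re `|x|.

Lemma normE x : `|x| = (nrm x)%:C%C.
Proof. by rewrite RRe_real// ger0_real. Qed.

Lemma nrm_ge0 x : 0 <= nrm x.
Proof. by rewrite -ler0c -normE. Qed.

Lemma nrm0 : nrm 0 = 0.
Proof. by rewrite /nrm normr0. Qed.

Lemma nrm_eq0 x : (nrm x == 0) = (x == 0).
Proof. by rewrite -(inj_eq (@complexI R)) -normE normr_eq0. Qed.

Lemma nrm_gt0 x : (0 < nrm x) = (x != 0).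
Proof. by rewrite lt0r nrm_ge0 andbT nrm_eq0. Qed.

Lemma nrmN x : nrm (- x) = nrm x.
Proof. by rewrite /nrm normrN. Qed.

Lemma nrm_dist x y : nrm (x - y) = nrm (y - x).
Proof. by rewrite /nrm distrC. Qed.

Lemma nrmD x y : nrm (x + y) <= nrm x + nrm y.
Proof. by rewrite -lecR rmorphD/= -!normE; exact: ler_normD. Qed.

Lemma nrmB x y : nrm (x - y) <= nrm x + nrm y.
Proof. by rewrite -(nrmN y) nrmD. Qed.

Lemma nrmZ a x : nrm (a *: x) = cabs a * nrm x.
Proof.
by apply: (@complexI R); rewrite rmorphM/= -!normE -cabsE normrZ.
Qed.

Lemma nrm_sum n (f : 'I_n -> X) : nrm (\sum_i f i) <= \sum_i nrm (f i).
Proof.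
elim/big_ind2: _ => [|x a y b xa yb|//]; first by rewrite nrm0.
by rewrite (le_trans (nrmD _ _))// lerD.
Qed.

Lemma nbhs_nrmP x (A : set X) :
  nbhs x A <-> exists2 e : R, 0 < e & forall y, nrm (x - y) < e -> A y.
Proof.
split=> [/nbhs_normP[e /= e0 eA]|[e e0 eA]].
  have eE : e = (complex.Re e)%:C%C by rewrite RRe_real// gtr0_real.
  exists (complex.Re e) => [|y xy]; first by rewrite -ltcR -eE.
  by apply: eA; rewrite /= eE normE ltcR.
apply/nbhs_normP; exists e%:C%C; first by rewrite /= ltcR.
by move=> y /=; rewrite normE ltcR => /eA.
Qed.

Lemma closed_nrmP (A : set X) : closed A <->
  forall x, (forall e : R, 0 < e -> exists2 y, A y & nrm (x - y) < e) -> A x.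
Proof.
split=> [clA x xA|clA x xA].
  apply: clA => B /nbhs_nrmP[e e0 eB]; have [y Ay xy] := xA e e0.
  by exists y; split=> //; exact: eB.
apply: clA => e e0.
have [|y [Ay xy]] := xA [set y | nrm (x - y) < e]; last by exists y.
by apply/nbhs_nrmP; exists e.
Qed.

Lemma closed_away (A : set X) x : closed A -> ~ A x ->
  exists2 e : R, 0 < e & forall y, A y -> e <= nrm (x - y).
Proof.
move=> /closed_nrmP clA nAx; apply: contrapT => noe; apply: nAx; apply: clA.
move=> e e0; apply: contrapT => noy; apply: noe; exists e => // y Ay.
by rewrite leNgt; apply/negP => xy; apply: noy; exists y.
Qed.

(** If [x] is not in [P], its distance to [P] is positive since [P] is closed,
    hence it is attained up to the factor [2]. *)
Lemma near_best_approximation (P : set X) x : closed P -> linsub P ->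
  exists2 p, P p & forall q, P q -> nrm (x - p) <= 2 * nrm (x - q).
Proof.
move=> clP lP; have [Px|nPx] := pselect (P x).
  by exists x => // q _; rewrite subrr nrm0 mulr_ge0 ?nrm_ge0.
have [e e0 eP] := closed_away clP nPx.
pose D := [set nrm (x - q) | q in P].
have eD : lbound D e by move=> _ [q Pq <-]; exact: eP.
have D0 : D !=set0 by exists (nrm (x - 0)); exists 0 => //; exact: linsub0.
have d0 : 0 < inf D by rewrite (lt_le_trans e0)// lb_le_inf.
have [|_ [p Pp <-] xp] := inf_adherent d0 (E := D).
  by split=> //; exists e.
exists p => // q Pq; have : inf D <= nrm (x - q).
  by apply: ge_inf; [exists e|exists q].
by move: xp => /=; lra.
Qed.

End Basics.

Definition bdd_by (X : normedModType R[i]) (f : X -> X) (b : R) : Prop :=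
  forall x, nrm (f x) <= b * nrm x.

Lemma bdd_by_ge0 (X : normedModType R[i]) (f : X -> X) b :
  bdd_by f b -> exists2 b', 0 <= b' & bdd_by f b'.
Proof.
move=> fb; exists `|b| => // x; rewrite (le_trans (fb x))//.
by rewrite ler_wpM2r ?nrm_ge0// ler_norm.
Qed.

Lemma closed_preimage_bdd (X : normedModType R[i]) (f : {linear X -> X}) b
    (A : set X) :
  bdd_by f b -> closed A -> closed (f @^-1` A).
Proof.
move=> /bdd_by_ge0[{}b b0 fb] /closed_nrmP clA; apply/closed_nrmP => x xA.
apply: clA => e e0; have b1 : 0 < b + 1 by rewrite ltr_wpDl.
have [y Ay xy] := xA (e / (b + 1)) (divr_gt0 e0 b1).
exists (f y) => //; rewrite -linearB (le_lt_trans (fb _))//.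
move: xy; rewrite ltr_pdivlMr//; have := nrm_ge0 (x - y); nra.
Qed.

End RealNorm.

(** * The open mapping theorem for sums of subspaces *)
Section OpenMapping.
Context (R : realType) (X : completeNormedModType R[i]).
Implicit Types (D M A : set X) (x y z : X).

Lemma half_expn_gt0 k : 0 < 2^-1 ^+ k :> R.
Proof. by rewrite exprn_gt0// invr_gt0. Qed.

Lemma nrm_nested_complete (u : nat -> X) (r : nat -> R) (c : R) :
  (forall k, nrm (u k.+1 - u k) <= r k - r k.+1) -> (forall k, 0 <= r k) ->
  (forall k, r k <= c * 2^-1 ^+ k) ->
  exists l, forall k, nrm (l - u k) <= r k.
Proof.
move=> ur r0 rc.
have [|||l lP] := @nested_balls_complete _ X u (fun k => (r k)%:C%C).
- by move=> k; rewrite normE -rmorphB/= lecR.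
- by move=> k; rewrite ler0c.
- move=> e e0; have eE : e = (complex.Re e)%:C%C by rewrite RRe_real// gtr0_real.
  have e'0 : 0 < complex.Re e by rewrite -ltcR -eE.
  have [k ck] := geometric_small c e'0; exists k.
  by rewrite eE ltcR (le_lt_trans (rc k)).
by exists l => k; have := lP k; rewrite normE lecR.
Qed.

Lemma nrm_series (A : set X) (u : nat -> X) (c : R) : closed A -> linsub A ->
  (forall k, A (u k)) -> (forall k, nrm (u k) <= c * 2^-1 ^+ k) ->
  exists l, [/\ A l, nrm l <= 2 * c &
    forall n, nrm (l - \sum_(k < n) u k) <= 2 * c * 2^-1 ^+ n].
Proof.
move=> clA lA Au uc.
have c0 : 0 <= c.
  by have := uc 0%N; rewrite expr0 mulr1; apply: le_trans; exact: nrm_ge0.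
have [|||l lP] := @nrm_nested_complete (fun n => \sum_(k < n) u k)
    (fun n => 2 * c * 2^-1 ^+ n) (2 * c).
- move=> k; rewrite big_ord_recr/= addrC addrK (le_trans (uc k))// exprS.
  by have := half_expn_gt0 k; lra.
- by move=> k; rewrite !mulr_ge0// ltW// half_expn_gt0.
- by [].
exists l; split=> //; last by have := lP 0%N; rewrite big_ord0 subr0 expr0 mulr1.
move/closed_nrmP: clA; apply=> e e0; have [n cn] := geometric_small (2 * c) e0.
exists (\sum_(k < n) u k); first by apply: linsub_sum => // k.
exact: le_lt_trans (lP n) cn.
Qed.

Lemma closed_geometric (A : set X) x (c : R) : closed A ->
  (forall n, exists2 y, A y & nrm (x - y) <= c * 2^-1 ^+ n) -> A x.
Proof.
move=> /closed_nrmP clA xA; apply: clA => e e0.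
have [n cn] := geometric_small c e0; have [y Ay xy] := xA n.
by exists y => //; exact: le_lt_trans xy cn.
Qed.

Context (f : {linear X -> X}) (b : R) (fb : bdd_by f b).
Context (D M : set X) (clD : closed D) (lD : linsub D)
  (clM : closed M) (lM : linsub M).

(** The remainder of an approximate lift is halved at each step, so the
    successive lifts form a convergent series; its sum is an exact lift modulo
    [M] because [M] is closed. *)
Lemma exact_lift_of_approximate (Z : set X) (C : R) : 0 <= C ->
  (forall z, Z z -> exists x m, [/\ D x, M m, Z (z - f x - m),
     nrm x <= C * nrm z & nrm (z - f x - m) <= nrm z / 2]) ->
  forall z, Z z -> exists x, [/\ D x, M (z - f x) & nrm x <= 2 * C * nrm z].
Proof.
move=> C0 approx z Zz.
have /choice[g gP] : forall y, exists xm : X * X, Z y ->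
    [/\ D xm.1, M xm.2, Z (y - f xm.1 - xm.2),
     nrm xm.1 <= C * nrm y & nrm (y - f xm.1 - xm.2) <= nrm y / 2].
  move=> y; have [Zy|nZy] := pselect (Z y); last by exists (0, 0).
  by have [x [m P]] := approx y Zy; exists (x, m).
pose s k := iter k (fun y => y - f (g y).1 - (g y).2) z.
have Zs k : Z (s k) by elim: k => //= k /gP[].
have ns k : nrm (s k) <= nrm z * 2^-1 ^+ k.
  elim: k => [|k IH]; first by rewrite expr0 mulr1.
  have [_ _ _ _] := gP _ (Zs k); rewrite /= -/(s k) exprSr => h.
  by rewrite (le_trans h)// mulrA ler_wpM2r.
have [||||l [Dl ln lP]] := @nrm_series D (fun k => (g (s k)).1) (C * nrm z) => //.
- by move=> k; case: (gP _ (Zs k)).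
- move=> k; have [_ _ _ h _] := gP _ (Zs k); rewrite (le_trans h)//.
  by rewrite -mulrA ler_wpM2l.
exists l; split => //; last by rewrite -mulrA.
have [b' b'0 fb'] := bdd_by_ge0 fb.
apply: (@closed_geometric _ _ (nrm z + b' * (2 * (C * nrm z)))) => // n.
exists (\sum_(k < n) (g (s k)).2).
  by apply: linsub_sum => // k; case: (gP _ (Zs k)).
have sn : s n = z - f (\sum_(k < n) (g (s k)).1) - \sum_(k < n) (g (s k)).2.
  elim: n => [|n IH]; first by rewrite !big_ord0 linear0 !subr0.
  rewrite !big_ord_recr/= -/(s n) {1}IH linearD !opprD !addrA.
  by congr (_ - _); rewrite addrAC.
have -> : z - f l - \sum_(k < n) (g (s k)).2 =
    s n - f (l - \sum_(k < n) (g (s k)).1).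
  by rewrite sn linearB opprB [in RHS](addrAC z) subrKA addrAC.
rewrite (le_trans (nrmB _ _))// mulrDl lerD//.
by rewrite (le_trans (fb' _))// -mulrA ler_wpM2l.
Qed.

(** A point of the closure is the limit of a sequence of the sum with
    geometrically decreasing increments; lifting the increments gives a
    convergent series in [D]. *)
Lemma closed_of_exact_lift (C : R) :
  (forall z, image_plus f D M z ->
     exists x, [/\ D x, M (z - f x) & nrm x <= C * nrm z]) ->
  closed (image_plus f D M).
Proof.
move=> lift; apply/closed_nrmP => y yZ.
have [b' b'0 fb'] := bdd_by_ge0 fb.
have /choice[z zP] : forall k, exists z, image_plus f D M z /\ nrm (y - z) < 2^-1 ^+ k.
  move=> k; have [|z Zz yz] := yZ (2^-1 ^+ k); last by exists z.
  exact: half_expn_gt0.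
have /choice[x xP] : forall k, exists x, [/\ D x, M (z k.+1 - z k - f x) &
    nrm x <= `|C| * 2 * 2^-1 ^+ k].
  move=> k; have [|x [Dx Mx nx]] := lift (z k.+1 - z k).
    by apply: linsubB; [exact: linsub_image_plus|case: (zP k.+1)|case: (zP k)].
  exists x; split=> //; rewrite (le_trans nx)//.
  apply: (@le_trans _ _ (`|C| * nrm (z k.+1 - z k))).
    by rewrite ler_wpM2r ?nrm_ge0// ler_norm.
  rewrite -mulrA ler_wpM2l//.
  rewrite -(subrKA y) (le_trans (nrmD _ _))// nrm_dist.
  have [_ h] := zP k; have [_] := zP k.+1; rewrite exprS.
  by have := half_expn_gt0 k; move: h; lra.
have [l [Dl ln lP]] := nrm_series clD lD (fun k => let: And3 h _ _ := xP k in h)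
   (fun k => let: And3 _ _ h := xP k in h).
have [[x0 Dx0 Mx0] _] := zP 0%N.
exists (x0 + l); first exact: linsubD.
apply: (@closed_geometric _ _ (1 + b' * (2 * (`|C| * 2)))) => // n.
exists (z n - f (x0 + \sum_(k < n) x k)).
  elim: n => [|n IH]; first by rewrite big_ord0 addr0.
  rewrite big_ord_recr/= addrA linearD opprD addrA.
  have [_ Mn _] := xP n; have := linsubD lM IH Mn.
  by rewrite addrA [_ - _ + (_ - _)]addrC subrKA.
rewrite opprD opprK addrACA [- f _ + _]addrC -linearB.
have -> : x0 + \sum_(k < n) x k - (x0 + l) = \sum_(k < n) x k - l.
  by rewrite opprD addrACA subrr add0r.
rewrite (le_trans (nrmD _ _))// mulrDl mul1r lerD//.
  by case: (zP n) => _ /ltW.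
by rewrite (le_trans (fb' _))// -mulrA ler_wpM2l// nrm_dist.
Qed.

(** This is the open mapping theorem for the map of [D * M] onto its closed
    image. By Baire's argument, applied to the closed set [f(D) + M] itself, the
    elements with a lift of norm at most [n] are dense in some ball; by
    translation and scaling every element has an approximate lift. *)
Lemma exact_lift_of_closed : closed (image_plus f D M) -> exists2 C : R, 0 <= C &
  forall z, image_plus f D M z ->
    exists x, [/\ D x, M (z - f x) & nrm x <= C * nrm z].
Proof.
move=> clZ; have lZ := linsub_image_plus f lD lM.
pose G (n : nat) z := exists x, [/\ D x, M (z - f x) & nrm x <= n%:R].
have [n [z0 [e [Zz0 e0 dense]]]] : exists n z0 (e : R),
    [/\ image_plus f D M z0, 0 < e &
    forall z, image_plus f D M z -> nrm (z - z0) <= e ->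
      forall r : R, 0 < r -> exists2 y, G n y & nrm (z - y) < r].
  apply: contrapT => nowhere.
  have /choice[F FP] : forall np : nat * (X * R), exists q : X * R,
      image_plus f D M np.2.1 -> 0 < np.2.2 ->
      [/\ image_plus f D M q.1, 0 < q.2, q.2 <= np.2.2 / 2,
          nrm (q.1 - np.2.1) <= np.2.2 / 2 &
          forall y, G np.1 y -> q.2 < nrm (q.1 - y)].
    move=> [k [z e]]/=; have [Zz|] := pselect (image_plus f D M z); last by exists (0, 0).
    have [e0|] := ltP 0 e; last by exists (0, 0).
    have [w [Zw wz [r r0 rG]]] : exists w,
        [/\ image_plus f D M w, nrm (w - z) <= e / 2 &
        exists2 r : R, 0 < r & forall y, G k y -> r <= nrm (w - y)].
      apply: contrapT => now; apply: nowhere; exists k, z, (e / 2); split=> //.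
        by rewrite divr_gt0.
      move=> w Zw wz r r0; apply: contrapT => noy; apply: now; exists w; split=> //.
      exists r => // y Gy; rewrite leNgt; apply/negP => wy.
      by apply: noy; exists y.
    exists (w, Num.min (e / 2) (r / 2)); split=> //=.
    - by rewrite lt_min !divr_gt0.
    - by rewrite ge_min lexx.
    - move=> y /rG; apply: lt_le_trans; rewrite gt_min; apply/orP; right.
      by rewrite ltr_pdivrMr// ltr_pMr// ltr1n.
  (* A sequence of shrinking balls, the next one avoiding [G k]. *)
  pose s := fix s k := if k is j.+1 then F (j, s j) else (0, 1).
  have sP k : (image_plus f D M) (s k).1 /\ 0 < (s k).2.
    elim: k => [|k [Zk ek]] /=; first by split=> //; exact: linsub0.
    by have [] := FP (k, s k) Zk ek.
  have sS k : [/\ (s k.+1).2 <= (s k).2 / 2,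
      nrm ((s k.+1).1 - (s k).1) <= (s k).2 / 2 &
      forall y, G k y -> (s k.+1).2 < nrm ((s k.+1).1 - y)].
    by have [Zk ek] := sP k; have [] := FP (k, s k) Zk ek.
  have small k : (s k).2 <= 1 * 2^-1 ^+ k.
    elim: k => [|k IH]; first by rewrite expr0 mulr1.
    have [h _ _] := sS k; rewrite (le_trans h)// exprSr mulrA.
    by rewrite ler_wpM2r.
  have [||l lP] := @nrm_nested_complete (fun k => (s k).1) (fun k => (s k).2) 1 _ _ small.
  - by move=> k; have [h1 h2 _] := sS k; move: h1 h2; lra.
  - by move=> k; case: (sP k) => _ /ltW.
  have Zl : image_plus f D M l.
    apply: (@closed_geometric _ _ 1) => // k; exists (s k).1; first by case: (sP k).
    exact: le_trans (lP k) (small k).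
  case: (Zl) => x Dx Mx; pose k := Num.bound (nrm x).
  have : G k l.
    by exists x; split=> //; apply/ltW/archi_boundP/nrm_ge0.
  have [_ _ h] := sS k; move/h; rewrite nrm_dist => /lt_le_trans/(_ (lP _)).
  by rewrite ltxx.
pose C := 4 * n%:R / e.
have C0 : 0 <= C by rewrite /C divr_ge0// ?mulr_ge0// ltW.
exists (2 * C); first by rewrite mulr_ge0.
apply: exact_lift_of_approximate => // z Zz.
have [->|z_neq0] := eqVneq z 0.
  exists 0, 0; rewrite linear0 !subr0 nrm0 mulr0 mul0r; split=> //; exact: linsub0.
have nz : 0 < nrm z by rewrite nrm_gt0.
pose t : R := e / (2 * nrm z); have t0 : 0 < t by rewrite divr_gt0// mulr_gt0.
have tz : t * nrm z = e / 2.
  by rewrite /t; field; rewrite gt_eqF.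
have e4 : 0 < e / 8 by rewrite divr_gt0.
have [||y1 [x1 [Dx1 Mx1 nx1]] y1P] := dense (z0 + t%:C%C *: z) _ _ _ e4.
- by apply: linsubD => //; exact: linsubZ.
- rewrite addrAC subrr add0r nrmZ cabs_real gtr0_norm// tz.
  by move: e0; lra.
have [|y2 [x2 [Dx2 Mx2 nx2]] y2P] := dense z0 Zz0 _ _ e4.
  by rewrite subrr nrm0 ltW.
pose a : R[i] := (t^-1)%:C%C.
have at1 : a * t%:C%C = 1 by rewrite /a -rmorphM/= mulVf ?gt_eqF.
have na : cabs a = t^-1 by rewrite cabs_real gtr0_norm// invr_gt0.
exists (a *: (x1 - x2)), (a *: ((y1 - f x1) - (y2 - f x2))); split.
- by apply: linsubZ => //; exact: linsubB.
- by apply: linsubZ => //; exact: linsubB.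
- apply: linsubB => //; last first.
    by apply: (image_plus_r f lD); apply: (linsubZ lM); exact: (linsubB lM).
  by apply: (image_plusB lD lM) => //; apply: (linsubZ lD); exact: (linsubB lD).
- rewrite nrmZ na /C /t.
  have -> : 4 * n%:R / e * nrm z = (e / (2 * nrm z))^-1 * (n%:R + n%:R).
    by field; rewrite !gt_eqF.
  apply: ler_wpM2l; first by rewrite invr_ge0 ltW.
  by rewrite (le_trans (nrmB _ _))// lerD.
- have -> : z - f (a *: (x1 - x2)) - a *: (y1 - f x1 - (y2 - f x2)) =
      a *: (z0 + t%:C%C *: z - y1 - (z0 - y2)).
    have {1}-> : z = a *: (t%:C%C *: z) by rewrite scalerA at1 scale1r.
    rewrite [f (a *: _)]linearZ -scalerBr -scalerBr; congr (a *: _).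
    rewrite linearB.
    have -> : y1 - f x1 - (y2 - f x2) = y1 - y2 - (f x1 - f x2).
      by rewrite opprD [in RHS]opprD addrACA.
    rewrite opprB [- (_ + (f x2 - _))]opprD addrACA subrr addr0.
    rewrite -[z0 + _ - _]addrA [- (z0 - _)]opprD addrACA subrr add0r.
    by rewrite opprD addrA.
  rewrite nrmZ na ler_pdivrMl// mulrA tz.
  have := nrmB (z0 + t%:C%C *: z - y1) (z0 - y2); move: y1P y2P.
  by lra.
Qed.

End OpenMapping.

(** * Riesz's lemma and small perturbations of subspaces *)
Section Riesz.
Context (R : realType).

Lemma complex_nested_complete (c : nat -> R[i]) (r : nat -> R) (b : R) :
  (forall k, cabs (c k.+1 - c k) <= r k - r k.+1) -> (forall k, 0 <= r k) ->
  (forall k, r k <= b * 2^-1 ^+ k) ->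
  exists l, forall k, cabs (l - c k) <= 2 * r k.
Proof.
move=> cr r0 rb.
have absRe (z : R[i]) : `|complex.Re z| <= cabs z.
  by rewrite -lecR; exact: normc_ge_Re.
have absIm (z : R[i]) : `|complex.Im z| <= cabs z.
  have := absRe (z * 'i%C); rewrite ReiNIm normrN => /le_trans; apply.
  by rewrite Normc.normcM [cabs 'i%C]/= expr0n expr1n add0r sqrtr1 mulr1.
have rsmall e : 0 < e -> exists k, r k < e.
  move=> e0; have [k bk] := geometric_small b e0.
  by exists k; exact: le_lt_trans (rb k) bk.
have [|x xP] := @nested_balls_complete _ R (fun k => complex.Re (c k)) r _ r0 rsmall.
  move=> k; rewrite (le_trans _ (cr k))// (le_trans _ (absRe _))//.
  by case: (c k) (c k.+1) => [? ?] [? ?].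
have [|y yP] := @nested_balls_complete _ R (fun k => complex.Im (c k)) r _ r0 rsmall.
  move=> k; rewrite (le_trans _ (cr k))// (le_trans _ (absIm _))//.
  by case: (c k) (c k.+1) => [? ?] [? ?].
exists (Complex x y) => k; have := xP k; have := yP k; case: (c k) => u v.
rewrite [complex.Re _]/= [complex.Im _]/= => hv hu.
have -> : Complex x y - Complex u v = (x - u)%:C%C + (y - v)%:C%C * 'i%C.
  by apply/eqP; rewrite eq_complex /=; apply/andP; split; apply/eqP; ring.
rewrite (le_trans (le_normcD _ _))// Normc.normcM !cabs_real.
rewrite [cabs 'i%C]/= expr0n expr1n add0r sqrtr1 mulr1.
by rewrite mulr2n mulrDl mul1r lerD.
Qed.

Context (X : completeNormedModType R[i]).
Implicit Types (A P : set X) (x y z : X).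

Definition add_line P z : set X := [set x | exists c, P (x - c *: z)].

Lemma linsub_add_line P z : linsub P -> linsub (add_line P z).
Proof.
move=> lP; split; first by exists 0; rewrite scale0r subr0; exact: linsub0.
move=> a x y [c Px] [c' Py]; exists (a * c + c').
by rewrite scalerDl -scalerA opprD addrACA -scalerBr; exact: lP.2.
Qed.

Lemma sub_add_line P z : P `<=` add_line P z.
Proof. by move=> x Px; exists 0; rewrite scale0r subr0. Qed.

Lemma coef_le_dist P z (d : R) : linsub P -> 0 < d ->
  (forall p, P p -> d <= nrm (z - p)) ->
  forall c p, P p -> d * cabs c <= nrm (c *: z - p).
Proof.
move=> lP d0 zP c p Pp; have [->|c0] := eqVneq c 0.
  by rewrite (Normc.normc0 R) mulr0 nrm_ge0.
have -> : c *: z - p = c *: (z - c^-1 *: p).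
  by rewrite scalerBr scalerA divff// scale1r.
by rewrite nrmZ mulrC ler_wpM2l ?cabs_ge0// zP//; exact: linsubZ.
Qed.

(** If [z] is not in [P], the distance from [z] to [P] controls the coefficient
    of [z], so the coefficients of a convergent sequence converge. *)
Lemma closed_add_line P z : closed P -> linsub P -> closed (add_line P z).
Proof.
move=> clP lP; have [Pz|nPz] := pselect (P z).
  suff -> : add_line P z = P by [].
  apply/seteqP; split; last exact: sub_add_line.
  by move=> x [c Px]; apply: linsubBl Px _ => //; exact: linsubZ.
have [d d0 dP] := closed_away clP nPz.
have cd := coef_le_dist lP d0 dP.
apply/closed_nrmP => x xP.
have /choice[yc ycP] : forall k, exists yc : X * R[i], P (yc.1 - yc.2 *: z) /\
    nrm (x - yc.1) < d / 4 * 2^-1 ^+ k.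
  move=> k; have [|y [c Py] xy] := xP (d / 4 * 2^-1 ^+ k); last by exists (y, c).
  by rewrite mulr_gt0 ?half_expn_gt0// divr_gt0.
have [|||l lc] := @complex_nested_complete (fun k => (yc k).2)
    (fun k => 2^-1 ^+ k) 1.
- move=> k; rewrite -(ler_pM2l d0).
  have [P1 d1] := ycP k; have [P2 d2] := ycP k.+1.
  have := cd ((yc k.+1).2 - (yc k).2)
    (((yc k).1 - (yc k).2 *: z) - ((yc k.+1).1 - (yc k.+1).2 *: z)) (linsubB lP P1 P2).
  have -> : ((yc k.+1).2 - (yc k).2) *: z -
      (((yc k).1 - (yc k).2 *: z) - ((yc k.+1).1 - (yc k.+1).2 *: z)) =
      (yc k.+1).1 - (yc k).1.
    by rewrite scalerBl opprB addrC addrACA subrK -opprD subrK.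
  have := nrmB (x - (yc k).1) (x - (yc k.+1).1).
  have -> : x - (yc k).1 - (x - (yc k.+1).1) = (yc k.+1).1 - (yc k).1.
    by rewrite opprB addrC subrKA.
  move: d1 d2; rewrite exprS; have := half_expn_gt0 R k.
  set h := 2^-1 ^+ k => h0.
  have : 0 < d * h by rewrite mulr_gt0.
  by lra.
- by move=> k; rewrite ltW// half_expn_gt0.
- by move=> k; rewrite mul1r.
exists l; apply: (closed_geometric (c := d / 4 + 2 * nrm z) clP) => n.
exists ((yc n).1 - (yc n).2 *: z); first by case: (ycP n).
have -> : x - l *: z - ((yc n).1 - (yc n).2 *: z) =
    x - (yc n).1 - (l - (yc n).2) *: z.
  by rewrite scalerBl !opprB addrACA [RHS]addrACA; congr (_ + _); rewrite addrC.
rewrite (le_trans (nrmB _ _))// mulrDl lerD//.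
  by case: (ycP n) => _ /ltW.
by rewrite nrmZ mulrAC ler_wpM2r ?nrm_ge0.
Qed.

(** The vector [z] is [x] minus a nearly best approximation of it in [P],
    normalized; it is at distance at least [1 / 2] from [P]. *)
Lemma riesz_step A P x : linsub A -> closed P -> linsub P -> P `<=` A ->
  A x -> ~ P x -> exists z, [/\ A z, nrm z = 1,
    forall c p, P p -> cabs c <= 2 * nrm (c *: z - p) &
    add_line P x = add_line P z].
Proof.
move=> lA clP lP PA Ax nPx; have [p Pp best] := near_best_approximation x clP lP.
pose w := x - p; have w0 : 0 < nrm w.
  rewrite nrm_gt0 subr_eq0; apply: contra_notN nPx => /eqP->; exact: Pp.
pose t : R[i] := (nrm w)%:C%C; have t0 : t != 0.
  by rewrite -cabs_gt0 cabs_real normr_gt0 gt_eqF.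
exists (t^-1 *: w); split.
- by apply: linsubZ => //; apply: linsubB => //; exact: PA.
- by rewrite nrmZ Normc.normcV cabs_real gtr0_norm// mulVf// gt_eqF.
- move=> c q Pq; suff : 2^-1 * cabs c <= nrm (c *: (t^-1 *: w) - q) by lra.
  apply: (coef_le_dist lP _ _ _ Pq) => // r Pr.
  have -> : t^-1 *: w - r = t^-1 *: (w - t *: r).
    by rewrite [RHS]scalerBr (scalerA _ t) mulVf// scale1r.
  rewrite nrmZ Normc.normcV cabs_real gtr0_norm// mulrC ler_pdivlMr//.
  have := best (p + t *: r) (linsubD lP Pp (linsubZ lP t Pr)).
  by rewrite opprD addrA -/w; lra.
- apply/seteqP; split=> y [c Py].
    exists (c * t); rewrite scalerA -mulrA divff// mulr1 /w scalerBr opprB.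
    by rewrite addrCA; apply: linsubD => //; exact: linsubZ.
  exists (c * t^-1); rewrite scalerA /w scalerBr opprB addrCA in Py.
  by have := linsubB lP Py (linsubZ lP (c * t^-1) Pp); rewrite addrAC subrr add0r.
Qed.

(** The constant [k] depends on [m] only. The family is built one vector at a
    time, each separated from [P] and the previous ones by [riesz_step]. *)
Lemma riesz_basis m : exists2 k : R, 0 < k &
  forall A P, linsub A -> closed P -> linsub P -> P `<=` A -> indep A P m ->
  exists z : 'I_m -> X, [/\ forall i, A (z i), forall i, nrm (z i) <= 1 &
    forall c p, P p -> forall i, k * cabs (c i) <= nrm (\sum_i c i *: z i - p)].
Proof.
elim: m => [|m [k k0 IH]].
  exists 1 => // A P _ _ _ _ _.
  by exists (fun=> 0); split => [[]|[]|c p _ []].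
exists (k / (2 * (k + m%:R + 1))).
  by rewrite divr_gt0// mulr_gt0// !ltr_wpDr ?ler0n.
move=> A P lA clP lP PA [e [Ae inde]].
have nPe : ~ P (e ord0).
  move=> Pe; have := inde (fun i => (i == ord0)%:R) _ ord0.
  rewrite eqxx => /(_ _)/eqP; rewrite oner_eq0 => h; apply: (notF (h _)).
  rewrite (bigD1 ord0)//= scale1r big1 ?addr0// => i /negPf->.
  by rewrite scale0r.
have [z0 [Az0 nz0 z0P eqline]] := riesz_step lA clP lP PA (Ae ord0) nPe.
have [||z [Az nz zP]] := IH A (add_line P z0) lA (closed_add_line clP lP)
    (linsub_add_line _ lP).
- by move=> x [c Px]; apply: linsubBl (PA _ Px) _ => //; exact: linsubZ.
- exists (fun i => e (lift ord0 i)); split=> // c; rewrite -eqline => -[a Pa] i.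
  pose c' j := if unlift ord0 j is Some l then c l else - a.
  have -> : c i = c' (lift ord0 i) by rewrite /c' liftK.
  apply: inde; rewrite big_ord_recl /c' unlift_none scaleNr addrC.
  by under eq_bigr do rewrite liftK.
exists (fun i => if unlift ord0 i is Some j then z j else z0); split.
- by move=> i; case: unliftP.
- by move=> i; case: unliftP => // _; rewrite nz0.
move=> c p Pp; set N := nrm _.
have NE : N = nrm (\sum_i c (lift ord0 i) *: z i - (p - c ord0 *: z0)).
  rewrite /N big_ord_recl unlift_none; under eq_bigr do rewrite liftK.
  by rewrite opprB addrA [in RHS](addrC _ (c ord0 *: z0)).
have hz i : k * cabs (c (lift ord0 i)) <= N.
  rewrite NE; apply: (zP (fun i => c (lift ord0 i))).
  by exists (- c ord0); rewrite scaleNr opprK subrK.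
(* The coefficient of [z0] is bounded through the others, at the cost of a
   worse constant. *)
pose S := \sum_i cabs (c (lift ord0 i)).
have kS : k * S <= m%:R * N.
  rewrite mulr_sumr (le_trans (ler_sum _ (fun i _ => hz i)))//.
  by rewrite sumr_const card_ord mulr_natl.
have c0 : cabs (c ord0) <= 2 * (N + S).
  rewrite (le_trans (z0P _ _ Pp))// ler_pM2l//.
  have -> : c ord0 *: z0 - p =
      \sum_i c (lift ord0 i) *: z i - (p - c ord0 *: z0) -
      \sum_i c (lift ord0 i) *: z i by rewrite addrAC subrr add0r opprB.
  rewrite (le_trans (nrmB _ _))// -NE lerD2l (le_trans (nrm_sum _))//.
  apply: ler_sum => i _; rewrite nrmZ ler_piMr ?cabs_ge0//.
have m0 : 0 <= m%:R :> R by rewrite ler0n.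
have N0 : 0 <= N by rewrite nrm_ge0.
have d0 : 0 < 2 * (k + m%:R + 1) by lra.
move=> i; rewrite mulrAC ler_pdivrMr//.
case: (unliftP ord0 i) => [j ->|->]; last by nra.
rewrite (le_trans (hz j))// ler_peMr//; lra.
Qed.

Lemma comb_eq0_of_small m (c : 'I_m -> R[i]) (k : R) : 0 < k ->
  (forall i, k * cabs (c i) <= k / (m%:R + 1) * \sum_j cabs (c j)) ->
  forall i, c i = 0.
Proof.
move=> k0 small; set S := \sum_j _ in small.
have m0 : 0 <= m%:R :> R by rewrite ler0n.
have m1 : 0 < m%:R + 1 :> R by lra.
have S0 : S <= 0.
  have : \sum_i cabs (c i) <= \sum_(i < m) S / (m%:R + 1).
    apply: ler_sum => i _; rewrite -(ler_pM2l k0) (le_trans (small i))//.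
    by rewrite mulrAC mulrA.
  rewrite -/S sumr_const card_ord -(mulr_natl (S / _)) mulrA ler_pdivlMr//.
  by nra.
move=> i; apply/eqP; rewrite -cabs_eq0 eq_le cabs_ge0 andbT.
rewrite (le_trans _ S0)// /S (bigD1 i)//= lerDl sumr_ge0// => j _.
exact: cabs_ge0.
Qed.

Lemma nrm_comb_le m (c : 'I_m -> R[i]) (z : 'I_m -> X) :
  (forall i, nrm (z i) <= 1) -> nrm (\sum_i c i *: z i) <= \sum_i cabs (c i).
Proof.
move=> z1; rewrite (le_trans (nrm_sum _))// ler_sum// => i _.
by rewrite nrmZ ler_piMr ?cabs_ge0.
Qed.

(** Vectors of [A] separated as in [riesz_basis], each replaced by a nearby vector
    of [A'], cannot become dependent modulo [P]. *)
Lemma indep_perturb_numerator m : exists2 d : R, 0 < d &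
  forall A A' P, linsub A -> closed P -> linsub P -> P `<=` A ->
  (forall x, A x -> exists2 x', A' x' & nrm (x - x') <= d * nrm x) ->
  indep A P m -> indep A' P m.
Proof.
have [k k0 riesz] := riesz_basis m.
have k1 : 0 < k / (m%:R + 1) by rewrite divr_gt0// ltr_wpDl ?ler0n.
exists (k / (m%:R + 1)) => // A A' P lA clP lP PA AA' indA.
have [z [Az nz zP]] := riesz A P lA clP lP PA indA.
have /choice[x xP] : forall i, exists x, A' x /\
    nrm (z i - x) <= k / (m%:R + 1).
  move=> i; have [x A'x zx] := AA' _ (Az i); exists x; split=> //.
  by rewrite (le_trans zx)// ler_piMr// ltW.
exists x; split=> [i|c Pc]; first by case: (xP i).
apply: (comb_eq0_of_small k0) => i; rewrite (le_trans (zP c _ Pc i))//.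
rewrite -sumrB (le_trans (nrm_sum _))// mulr_sumr ler_sum// => j _.
by rewrite -scalerBr nrmZ mulrC ler_wpM2r ?cabs_ge0//; case: (xP j).
Qed.

(** A combination, separated from [P] as in [riesz_basis], that lies in [P'] is
    close to [P], hence trivial. *)
Lemma indep_perturb_denominator m : exists2 d : R, 0 < d &
  forall P P', closed P -> linsub P ->
  (forall y, P' y -> exists2 p, P p & nrm (y - p) <= d * nrm y) ->
  indep [set: X] P m -> indep [set: X] P' m.
Proof.
have [k k0 riesz] := riesz_basis m.
have k1 : 0 < k / (m%:R + 1) by rewrite divr_gt0// ltr_wpDl ?ler0n.
exists (k / (m%:R + 1)) => // P P' clP lP PP' indP.
have [z [_ nz zP]] := riesz [set: X] P (linsubT X) clP lP (@subsetT _ _) indP.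
exists z; split=> // c /PP' [p Pp cp].
apply: (comb_eq0_of_small k0) => i; rewrite (le_trans (zP c _ Pp i))//.
by rewrite (le_trans cp)// ler_wpM2l ?nrm_comb_le// ltW.
Qed.

End Riesz.

(** The segment from [0] to [v] is cut into steps of length at most [s]; it stays
    in the disk by convexity. *)
Lemma disk_chain (R : realType) (Q : R[i] -> Prop) (r s : R) : 0 < s ->
  (forall a b, cabs a <= r -> cabs b <= r -> cabs (a - b) <= s -> Q a -> Q b) ->
  forall v, cabs v <= r -> Q 0 <-> Q v.
Proof.
move=> s0 QQ v vr; pose N := (Num.bound (cabs v / s)).+1.
pose t k : R[i] := (k%:R / N%:R : R)%:C%C * v.
have N0 : 0 < N%:R :> R by rewrite ltr0n.
have vs0 : 0 <= cabs v / s by rewrite divr_ge0 ?cabs_ge0// ltW.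
have tN k : (k <= N)%N -> cabs (t k) <= r.
  move=> kN; rewrite Normc.normcM cabs_real ger0_norm ?divr_ge0//.
  rewrite (le_trans _ vr)// ler_piMl ?cabs_ge0// ler_pdivrMr// mul1r.
  by rewrite ler_nat.
have tS k : cabs (t k.+1 - t k) <= s.
  rewrite -mulrBl -rmorphB -mulrBl -natrB ?leqnSn// subSnn Normc.normcM.
  rewrite cabs_real ger0_norm ?divr_ge0// mulrAC mul1r ler_pdivrMr//.
  rewrite -ler_pdivrMl// mulrC ltW// (lt_trans (archi_boundP vs0))//.
  by rewrite ltr_nat.
have t0 : t 0%N = 0 by rewrite /t mul0r mul0r.
have tv : t N = v by rewrite /t divff ?gt_eqF// mul1r.
have Qt k : (k <= N)%N -> Q 0 <-> Q (t k).
  elim: k => [|k IH] kN; first by rewrite t0.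
  rewrite (IH (ltnW kN)); split; apply: QQ; rewrite ?tN// ?(ltnW kN)//.
  by rewrite cabs_dist.
by rewrite (Qt N)// tv.
Qed.

(** * Iterated ranges and the index *)
Section Powers.
Context (R : realType) (X : normedModType R[i]).
Implicit Types (S : {linear X -> X}) (x y : X).

(** The iterates, under a name to which the structure of a linear map can be
    attached. *)
Definition lin_iter S n : X -> X := iter n S.

Lemma lin_iter_is_linear S n : linear (lin_iter S n).
Proof. by rewrite /lin_iter => a x y; elim: n => //= n ->; rewrite linearP. Qed.

HB.instance Definition _ S n :=
  GRing.isLinear.Build R[i] X X _ (lin_iter S n) (lin_iter_is_linear S n).

Lemma lin_iterS S n x : lin_iter S n (S x) = lin_iter S n.+1 x.
Proof. by rewrite /lin_iter -iterSr. Qed.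

Lemma lin_iter_comm S n x : lin_iter S n (S x) = S (lin_iter S n x).
Proof. by rewrite lin_iterS. Qed.

Lemma linsub_range S n : linsub (range_pow S n).
Proof.
split; first by exists 0 => //; exact: (linear0 (lin_iter S n)).
move=> a _ _ [x _ <-] [y _ <-]; exists (a *: x + y) => //.
exact: (linearP (lin_iter S n)).
Qed.

Lemma linsub_null S : linsub (null_space S).
Proof.
split; first exact: linear0.
by rewrite /null_space/= => a x y Sx Sy; rewrite linearP Sx Sy scaler0 addr0.
Qed.

Lemma range_iter S n x : range_pow S n (lin_iter S n x). Proof. by exists x. Qed.

Lemma range_step S n x : range_pow S n x -> range_pow S n.+1 (S x).
Proof. by move=> [y _ <-]; exists y. Qed.

Lemma range_stepV S n x : range_pow S n.+1 x -> exists2 y, range_pow S n y & x = S y.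
Proof. by move=> [y _ <-]; exists (iter n S y) => //; exists y. Qed.

Lemma range_leq S m n : (m <= n)%N -> range_pow S n `<=` range_pow S m.
Proof.
move=> /subnKC <- _ [x _ <-]; exists (iter (n - m) S x) => //.
by rewrite -iterD.
Qed.

Lemma image_range S n : S @` range_pow S n = range_pow S n.+1.
Proof.
apply/seteqP; split=> [_ [x Rx <-]|x /range_stepV[y Ry ->]].
  exact: range_step.
by exists y.
Qed.

Lemma alpha_step S n : alpha_on (range_pow S n) S =
  (desc_k S n + alpha_on (range_pow S n.+1) S)%E.
Proof.
have lR := linsub_range S; have lN := linsub_null S.
apply: quot_dimD; [exact: linsubI|exact: linsubI|exact: linsub_0| |].
  by move=> x [/range_leq Rx Nx]; split=> //; exact: Rx.
by move=> x ->; apply: linsub0; exact: linsubI.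
Qed.

Lemma beta_onE S n : beta_on (range_pow S n) S =
  quot_dim (range_pow S n) (range_pow S n.+1).
Proof. by rewrite /beta_on image_range. Qed.

(** The intermediate space is [B = (R(S^n) meet N(S)) + R(S^(n+1))]: modulo
    [R(S^(n+1))] it has dimension [k_n(S)], and [S] maps [R(S^n) / B]
    isomorphically onto [R(S^(n+1)) / R(S^(n+2))]. *)
Lemma beta_step S n : beta_on (range_pow S n) S =
  (desc_k S n + beta_on (range_pow S n.+1) S)%E.
Proof.
have lR := linsub_range S; have lN := linsub_null S.
rewrite !beta_onE.
pose B := [set x | exists2 u, (range_pow S n `&` null_space S) u &
  range_pow S n.+1 (x - u)].
have lB : linsub B.
  split; first by exists 0; [apply: linsub0; exact: linsubI|rewrite subr0; exact: linsub0].
  move=> a x y [u Nu xu] [v Nv yv]; exists (a *: u + v); first exact: (linsubI _ _).2.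
  by rewrite opprD addrACA -scalerBr; exact: (lR n.+1).2.
have BR : B `<=` range_pow S n.
  by move=> x [u [Ru _] /(range_leq (leqnSn n)) xu]; exact: linsubBl xu Ru.
have RB : range_pow S n.+1 `<=` B.
  by move=> x Rx; exists 0; [apply: linsub0; exact: linsubI|rewrite subr0].
rewrite (quot_dimD (B := B))// addeC; congr (_ + _)%E.
  apply/esym/(quot_dim_iso (phi := idfun)) => //.
  - exact: linsubI.
  - exact: linsubI.
  - by move=> x Nx; exists x => //; rewrite subrr; exact: linsub0.
  - by move=> x [/(range_leq (leqnSn n)) Rx Nx].
  - by move=> x [Rx Nx]; split=> [[]|].
apply: (quot_dim_iso (phi := S)) => //.
- by move=> x /range_step.
- by move=> y /range_stepV[x Rx ->]; exists x => //; rewrite subrr; exact: linsub0.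
- move=> x Rx; split=> [[u [_ Nu] /range_step]|].
    by rewrite linearB Nu subr0.
  move=> /range_stepV[y Ry Sxy]; exists (x - y); last by rewrite subKr.
  split; last by rewrite /null_space/= linearB Sxy subrr.
  by apply: linsubB => //; apply: range_leq Ry.
Qed.

Lemma desc_k_cases S n :
  (exists k : nat, desc_k S n = (k%:Z)%:E) \/ desc_k S n = +oo%E.
Proof.
rewrite /desc_k; case: quot_dimP => [|k e _ _|_]; [|by left; exists k|by right].
by apply: linsubI; [exact: linsub_range|exact: linsub_null].
Qed.

Lemma ind_le0 S n : (alpha_on (range_pow S n) S < +oo)%E ->
  (ind_on (range_pow S n) S <= 0)%E =
  (alpha_on (range_pow S n) S <= beta_on (range_pow S n) S)%E.
Proof.
rewrite /ind_on /alpha_on /vdim beta_onE.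
case: (quot_dimP _ (linsub_0 X)) => // m _ _ _ _.
case: (quot_dimP _ (linsub_range S n.+1)) => [k _ _ _|_]; last by rewrite leey.
by rewrite -EFinB !lee_fin subr_le0.
Qed.

(** Both sides change by [k_n(S)], which is finite because the nullity is. *)
Lemma alpha_le_beta_step S n : (alpha_on (range_pow S n) S < +oo)%E ->
  (alpha_on (range_pow S n.+1) S < +oo)%E /\
  ((alpha_on (range_pow S n) S <= beta_on (range_pow S n) S)%E =
   (alpha_on (range_pow S n.+1) S <= beta_on (range_pow S n.+1) S)%E).
Proof.
rewrite alpha_step beta_step; have [[k ->]|->] := desc_k_cases S n.
  rewrite /alpha_on /vdim.
  case: (quot_dimP (range_pow S n.+1 `&` _) (linsub_0 X)) => // m _ _ _ _.
  split; first exact: ltry.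
  rewrite beta_onE; case: (quot_dimP _ (linsub_range S n.+2)) => [j _ _ _|_].
    by rewrite -!EFinD !lee_fin lerD2l.
  by rewrite addey// !leey.
rewrite /alpha_on /vdim; case: (quot_dimP _ (linsub_0 X)) => //.
Qed.

Lemma alpha_le_beta_leq S n m : (n <= m)%N ->
  (alpha_on (range_pow S n) S < +oo)%E ->
  (alpha_on (range_pow S m) S < +oo)%E /\
  ((alpha_on (range_pow S n) S <= beta_on (range_pow S n) S)%E =
   (alpha_on (range_pow S m) S <= beta_on (range_pow S m) S)%E).
Proof.
move=> nm an; elim: m nm => [|m IH]; first by rewrite leqn0 => /eqP<-.
rewrite leq_eqVlt => /predU1P[<-//|/IH[am ->]].
exact: alpha_le_beta_step.
Qed.

(** By [alpha_le_beta_leq], the sign of the index is the same at any two exponents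
    at which the restriction is upper semi-Fredholm. *)
Lemma upper_semi_B_WeylP S : upper_semi_B_Weyl S <->
  exists2 n, B_Fredholm_at S n &
    (alpha_on (range_pow S n) S <= beta_on (range_pow S n) S)%E.
Proof.
rewrite /upper_semi_B_Weyl /upper_semi_B_Fredholm /B_ind.
have finB n : B_Fredholm_at S n -> (alpha_on (range_pow S n) S < +oo)%E by case=> _ [].
split=> [[[n Bn]]|[n Bn ab]].
  case: xgetP => [m _ Bm|/(_ n)//]; rewrite ind_le0; last exact: finB.
  by move=> ab; exists m.
split; first by exists n.
case: xgetP => [m _ Bm|/(_ n)//]; rewrite ind_le0; last exact: finB.
have [nm|/ltnW mn] := leqP n m.
  by rewrite -(alpha_le_beta_leq nm (finB _ Bn)).2.
by rewrite (alpha_le_beta_leq mn (finB _ Bm)).2.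
Qed.

Lemma range0 S : range_pow S 0 = [set: X].
Proof. by apply/seteqP; split=> // x _; exists x. Qed.

Lemma closed_subspace_range S n : closed (range_pow S n.+1) ->
  closed (S @` range_pow S n : set (subspace (range_pow S n))).
Proof.
move=> clR; apply/closed_subspaceP; exists (range_pow S n.+1) => //.
by rewrite image_range.
Qed.

Lemma upper_semi_WeylP S : upper_semi_Weyl S <->
  [/\ closed (range_pow S 1), (alpha_on (range_pow S 0) S < +oo)%E &
    (alpha_on (range_pow S 0) S <= beta_on (range_pow S 0) S)%E].
Proof.
rewrite /upper_semi_Weyl /upper_semi_Fredholm_on -(range0 S).
split=> [[[a cl]]|[cl a ab]]; rewrite ind_le0//.
  split=> //; move/closed_subspaceP: cl => [V clV].
  by rewrite image_range range0 !setIT => <-.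
by do !split=> //; exact: closed_subspace_range.
Qed.

Lemma upper_semi_B_Weyl_of_Weyl S : upper_semi_Weyl S -> upper_semi_B_Weyl S.
Proof.
move=> /upper_semi_WeylP[cl a ab]; apply/upper_semi_B_WeylP; exists 0%N => //.
split; last by split=> //; exact: closed_subspace_range.
by rewrite range0; exact: closedT.
Qed.

End Powers.

(** * The shifted operators *)
Lemma linear_ext (R : pzRingType) (U V : lmodType R) (f g : {linear U -> V}) :
  f =1 g -> f = g.
Proof.
case: f g => f [[fa] [fs]] [g [[ga] [gs]]] /= /funext fg.
by case: _ / fg in ga gs *; rewrite (Prop_irrelevance fa ga) (Prop_irrelevance fs gs).
Qed.

Section Shift.
Context (R : realType) (X : normedModType R[i]).
Implicit Types (S : {linear X -> X}) (v : R[i]) (x : X).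

Lemma shift_opE S v x : shift_op S v x = S x - v *: x. Proof. by []. Qed.

Lemma shift_op0 S : shift_op S 0 = S.
Proof. by apply: linear_ext => x; rewrite shift_opE scale0r subr0. Qed.

Lemma shift_op_add S u v : shift_op (shift_op S u) v = shift_op S (u + v).
Proof. by apply: linear_ext => x; rewrite !shift_opE scalerDl opprD addrA. Qed.

Lemma shift_op_sub S u v x :
  shift_op S u x - shift_op S v x = (v - u) *: x.
Proof. by rewrite !shift_opE opprB addrC addrA subrK scalerBl. Qed.

Lemma bdd_by_shift S b v : bdd_by S b -> bdd_by (shift_op S v) (b + cabs v).
Proof.
by move=> Sb x; rewrite shift_opE (le_trans (nrmB _ _))// mulrDl lerD// nrmZ.
Qed.

Lemma bdd_by_iter S b n : bdd_by S b -> exists b', bdd_by (lin_iter S n) b'.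
Proof.
move=> /bdd_by_ge0[{}b b0 Sb]; exists (b ^+ n) => x; elim: n => [|n IH].
  by rewrite expr0 mul1r.
by rewrite (le_trans (Sb _))// exprS -mulrA ler_wpM2l.
Qed.

End Shift.

(** * Algebraic consequences of uniform descent *)
Section UniformDescent.
Context (R : realType) (X : normedModType R[i]) (S : {linear X -> X}) (d : nat).
Context (tud : TUD S d).
Implicit Types (v : R[i]) (x : X).

Definition iter_kernel : set X := [set x | lin_iter S d x = 0].

(** The preimage under [S^d] of the intersection of all the ranges [R(S^n)]. *)
Definition core : set X :=
  [set x | forall n, (d <= n)%N -> range_pow S n (lin_iter S d x)].

Notation M := iter_kernel.
Notation H := core.

(** [k_n(S) = 0] for [n >= d] means that the spaces [R(S^n) meet N(S)] are all
    equal from [n = d] on. *)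
Lemma null_range n x : (d <= n)%N -> range_pow S d x -> S x = 0 -> range_pow S n x.
Proof.
case: tud => k0 _; elim: n x => [|n IH] x; first by rewrite leqn0 => /eqP->.
rewrite leq_eqVlt => /predU1P[<-//|dn] Rx Sx.
have lRN : linsub (range_pow S n.+1 `&` null_space S).
  by apply: linsubI; [exact: linsub_range|exact: linsub_null].
by have [] := quot_dim_eq0 lRN (k0 n dn) (conj (IH x dn Rx Sx) Sx).
Qed.

(** [S^d] is continuous from [X] to [R(S^d)] with the operator range norm, which is
    the quotient norm. *)
Lemma closed_preimage_range n : (d <= n)%N ->
  closed [set x | range_pow S n (lin_iter S d x)].
Proof.
move=> dn; have [_ /(_ n dn)[_ [_ opn]]] := tud.
apply/closed_nrmP => x xR; apply: contrapT => nRx.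
have [e e0 eP] := opn (lin_iter S d x) (conj (range_iter S d x) nRx).
have [y Ry xy] := xR e e0.
have [] // := eP (lin_iter S d y) (range_iter S d y).
apply: le_lt_trans xy; rewrite nrm_dist; apply: ge_inf; last first.
  by exists (y - x) => //=; rewrite -linearB.
by exists 0 => _ [z _ <-]; exact: nrm_ge0.
Qed.

Lemma linsub_iter_kernel : linsub M.
Proof.
split=> [|a x y]; rewrite /iter_kernel/= ?linear0// => Mx My.
by rewrite linearP/= Mx My scaler0 addr0.
Qed.

Lemma closed_iter_kernel b : bdd_by S b -> closed M.
Proof.
move=> /(bdd_by_iter d)[b' Sb]; rewrite (_ : M = lin_iter S d @^-1` [set 0])//.
apply: (closed_preimage_bdd Sb).
apply/closed_nrmP => x x0; apply: contrapT => /eqP; rewrite -nrm_gt0 => xpos.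
by have [y ->] := x0 _ xpos; rewrite subr0 ltxx.
Qed.

Lemma linsub_core : linsub H.
Proof.
split=> [n _|a x y Hx Hy n dn].
  by rewrite linear0; apply: linsub0; exact: linsub_range.
by rewrite linearP; apply: (linsub_range S n).2; [exact: Hx|exact: Hy].
Qed.

Lemma closed_core : closed H.
Proof.
apply/closed_nrmP => x xH n dn; have /closed_nrmP := closed_preimage_range dn.
by apply=> e /xH[y Hy xy]; exists y => //; exact: Hy.
Qed.

Lemma iter_kernel_sub_core : M `<=` H.
Proof. by move=> x Mx n _; rewrite Mx; apply: linsub0; exact: linsub_range. Qed.

Lemma iter_kernel_stable x : M x -> M (S x).
Proof. by rewrite /iter_kernel/= lin_iter_comm => ->; rewrite linear0. Qed.

Lemma core_stable x : H x -> H (S x).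
Proof.
move=> Hx n dn; rewrite lin_iter_comm.
by apply: (range_leq (leqnSn n)); apply: range_step; exact: Hx.
Qed.

Lemma core_shift v x : H x -> H (shift_op S v x).
Proof.
have lH := linsub_core.
move=> Hx; rewrite shift_opE.
by apply: (linsubB lH); [exact: core_stable|exact: (linsubZ lH)].
Qed.

(** If [S^d (S x) = S y] with [y] in [R(S^n)], then [S^d x - y] is in the null space
    and in [R(S^d)], hence in [R(S^n)]. So [S] is injective modulo [core]. *)
Lemma core_stableV x : H (S x) -> H x.
Proof.
move=> HSx n dn; have := HSx _ (leqW dn); rewrite lin_iter_comm.
move=> /range_stepV[y Ry Sxy]; have lR := linsub_range S.
apply: (linsubBl (y := y)) => //; apply: null_range => //.
  by apply: linsubB => //; [exact: range_iter|exact: range_leq Ry].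
by rewrite linearB Sxy subrr.
Qed.

Lemma core_surj y : H y -> exists2 x, H x & M (y - S x).
Proof.
move=> Hy; have /range_stepV[_ [x _ <-] Syx] := Hy _ (leqnSn d).
have Mx : M (y - S x).
  by rewrite /iter_kernel/= linearB/= lin_iter_comm Syx subrr.
exists x => //; apply: core_stableV; apply: (linsubBr linsub_core _ Hy).
exact: iter_kernel_sub_core.
Qed.

Lemma sum_range_coreE x :
  image_plus S [set: X] H x <-> range_pow S d.+1 (lin_iter S d x).
Proof.
have lR := linsub_range S d.+1; split=> [[y _ Hxy]|].
  rewrite -(subrK (S y) x) linearD/=; apply: linsubD => //; first exact: Hxy.
  by rewrite lin_iter_comm; apply: range_step; exact: range_iter.
move=> /range_stepV[_ [y _ <-] Sxy]; exists y => //; apply: iter_kernel_sub_core.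
by rewrite /iter_kernel/= linearB/= lin_iter_comm Sxy subrr.
Qed.

Definition shift_preimage v : set X := [set x | M (shift_op S v x)].
Notation K := shift_preimage.

Lemma linsub_shift_preimage v : linsub (K v).
Proof.
have lM := linsub_iter_kernel.
split; first by rewrite /shift_preimage /mkset linear0; exact: (linsub0 lM).
by move=> a x y Kx Ky; rewrite /shift_preimage /mkset linearP; exact: lM.2.
Qed.

Lemma iter_kernel_sub_preimage v : M `<=` K v.
Proof.
have lM := linsub_iter_kernel.
move=> x Mx; rewrite /shift_preimage /mkset shift_opE.
by apply: (linsubB lM); [exact: iter_kernel_stable|exact: (linsubZ lM)].
Qed.

Lemma shift_preimageP v x :
  K v x <-> S (lin_iter S d x) = v *: lin_iter S d x.
Proof.
rewrite /shift_preimage /iter_kernel /mkset shift_opE linearB linearZ/= lin_iter_comm.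
by split=> [/eqP|->]; [rewrite subr_eq0 => /eqP|rewrite subrr].
Qed.

(** For [v <> 0] the vector [S^d x] is an eigenvector for a nonzero eigenvalue, so
    it lies in every range; for [v = 0] this is [core_stableV]. *)
Lemma shift_preimage_sub_core v : K v `<=` H.
Proof.
move=> x /shift_preimageP; have [->|v0] := eqVneq v 0.
  rewrite scale0r -lin_iter_comm => Sx; apply: core_stableV.
  exact: iter_kernel_sub_core.
move=> eig n _; elim: n => [|n IH].
  by rewrite range0.
have -> : lin_iter S d x = v^-1 *: S (lin_iter S d x).
  by rewrite eig scalerA mulVf// scale1r.
by apply: linsubZ; [exact: linsub_range|exact: range_step].
Qed.

Lemma alpha_preimage0 : quot_dim (K 0) M = alpha_on (range_pow S d) S.
Proof.
have lM := linsub_iter_kernel.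
apply: (quot_dim_iso (phi := lin_iter S d)) => //.
- exact: linsub_shift_preimage.
- exact: linsub_0.
- move=> x /shift_preimageP; rewrite scale0r => Sx.
  by split=> //; exact: range_iter.
- move=> _ [[x _ <-] Sx]; exists x; last by rewrite subrr.
  by apply/shift_preimageP; rewrite scale0r.
- exact: iter_kernel_sub_preimage.
Qed.

Lemma beta_image_plus0 :
  quot_dim [set: X] (image_plus (shift_op S 0) [set: X] H) =
  beta_on (range_pow S d) S.
Proof.
rewrite shift_op0 beta_onE.
apply: (quot_dim_iso (phi := lin_iter S d)) => //.
- exact: linsub_range.
- apply: linsub_image_plus => //; exact: linsub_core.
- by move=> x _; exact: range_iter.
- move=> _ [x _ <-]; exists x => //; rewrite subrr.
  by apply: linsub0; exact: linsub_range.
- by move=> x _; exact: sum_range_coreE.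
Qed.

Section NonzeroShift.
Context (v : R[i]) (v0 : v != 0).

Lemma null_shift_iter x n : shift_op S v x = 0 -> lin_iter S n x = v ^+ n *: x.
Proof.
move=> /eqP; rewrite shift_opE subr_eq0 => /eqP eig.
elim: n => [|n IH]; first by rewrite expr0 scale1r.
by rewrite -lin_iterS eig linearZ/= IH scalerA exprS.
Qed.

(** The projection onto the eigenspace along [iter_kernel] is [v^-d *: S^d] on
    [K v]. *)
Lemma alpha_preimage : quot_dim (K v) M = alpha_on (range_pow (shift_op S v) 0) (shift_op S v).
Proof.
have lM := linsub_iter_kernel.
apply/esym/(quot_dim_iso (phi := idfun)) => //.
- by apply: linsubI; [exact: linsub_range|exact: linsub_null].
- exact: linsub_0.
- by move=> x [_ Nx]; rewrite /shift_preimage /mkset Nx; exact: (linsub0 lM).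
- move=> x /shift_preimageP Kx; pose w := lin_iter S d x.
  have Nw : shift_op S v w = 0.
    by rewrite shift_opE Kx subrr.
  exists (v ^- d *: w).
    by split; [rewrite range0|rewrite /null_space /mkset linearZ Nw; exact: scaler0].
  rewrite /iter_kernel/= linearB linearZ/= (null_shift_iter _ Nw) scalerA.
  by rewrite mulVf ?expf_neq0// scale1r subrr.
- by move=> _ ->; apply: linsub0; apply: linsubI; [exact: linsub_range|exact: linsub_null].
- move=> x [_ Nx]; split=> [->|/=]; first exact: linsub0.
  rewrite /iter_kernel/= (null_shift_iter _ Nx) => /eqP.
  by rewrite scaler_eq0 expf_eq0 (negPf v0) andbF => /eqP.
Qed.

(** On the null space of [S^j] the operator [S] is nilpotent, so [S - v] is
    invertible. *)
Lemma iter_kernel_shift_surj j x : lin_iter S j x = 0 ->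
  exists2 y, lin_iter S j y = 0 & x = shift_op S v y.
Proof.
elim: j x => [|j IH] x; first by move=> x0; exists 0; rewrite !linear0.
move=> Sx; have [|u Su Sxu] := IH (S x); first by rewrite lin_iterS.
exists (v^-1 *: (u - x)).
  have -> : lin_iter S j.+1 (v^-1 *: (u - x)) =
      v^-1 *: (S (lin_iter S j u) - lin_iter S j.+1 x) by rewrite linearZ linearB.
  by rewrite Sx Su linear0 subr0 scaler0.
rewrite linearZ linearB -Sxu (shift_opE S v x) subKr.
by rewrite [RHS]scalerA mulVf// scale1r.
Qed.

End NonzeroShift.
End UniformDescent.

(** * The punctured neighbourhood theorem *)
Section PuncturedDisk.
Context (R : realType) (X : completeNormedModType R[i]).
Context (S : {linear X -> X}) (b : R) (Sb : bdd_by S b).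
Context (d : nat) (tud : TUD S d).
Implicit Types (v : R[i]) (x y : X).

Local Notation M := (iter_kernel S d).
Local Notation H := (core S d).
Local Notation K v := (shift_preimage S d v).

Definition sum_range v : set X := image_plus (shift_op S v) [set: X] H.

Let lM : linsub M := linsub_iter_kernel S d.
Let lH : linsub H := linsub_core S d.
Let clM : closed M := closed_iter_kernel Sb.
Let clH : closed H := closed_core tud.

Lemma core_lift0 : exists2 C : R, 0 <= C & forall y, H y ->
  exists x, [/\ H x, M (y - S x) & nrm x <= C * nrm y].
Proof.
have E : image_plus S H M = H.
  apply/seteqP; split=> y; last by move=> /(core_surj tud)[x Hx Mx]; exists x.
  move=> [x Hx Mx]; apply: (linsubBl lH (y := S x)); last exact: core_stable.
  exact: iter_kernel_sub_core.
have := exact_lift_of_closed Sb clH lH clM lM.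
by rewrite E; apply.
Qed.

(** On [X / H] the operator induced by [S] is injective with closed range, hence
    bounded below. *)
Lemma core_dist0 : exists2 C : R, 0 <= C & forall x h, H h ->
  exists2 h', H h' & nrm (x - h') <= C * nrm (S x - h).
Proof.
have E : image_plus S [set: X] H =
    [set x | range_pow S d.+1 (lin_iter S d x)].
  by apply/seteqP; split=> x /(sum_range_coreE S d).
have := exact_lift_of_closed Sb (@closedT X) (linsubT X) clH lH.
rewrite E => /(_ (closed_preimage_range tud (leqnSn d)))[C C0 CP].
exists C => // x h Hh; have [|y [_ Hy ny]] := CP (S x - h).
  by rewrite -E; exists x => //; rewrite addrAC subrr add0r; exact: (linsubN lH).
exists (x - y); last by rewrite subKr.
apply: (core_stableV tud); rewrite linearB.
by have := linsubD lH Hy Hh; rewrite addrAC subrK.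
Qed.

Lemma core_constant : exists2 C : R, 0 < C &
  (forall y, H y -> exists x, [/\ H x, M (y - S x) & nrm x <= C * nrm y]) /\
  (forall x h, H h -> exists2 h', H h' & nrm (x - h') <= C * nrm (S x - h)).
Proof.
have [C1 C10 lift] := core_lift0; have [C2 C20 dist] := core_dist0.
exists (C1 + C2 + 1); first by lra.
split=> [y Hy|x h Hh].
  have [x [Hx Mx nx]] := lift y Hy; exists x; split=> //.
  by rewrite (le_trans nx)// ler_wpM2r ?nrm_ge0//; lra.
have [h' Hh' nh] := dist x h Hh; exists h' => //.
by rewrite (le_trans nh)// ler_wpM2r ?nrm_ge0//; lra.
Qed.

(** The radius [1 / (4 C)] makes [v] a small perturbation for both the surjectivity
    of [S] on [H] modulo [M] and its lower bound modulo [H]. *)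
Section Disk.
Context (C : R) (C0 : 0 < C).
Context (lift : forall y, H y ->
  exists x, [/\ H x, M (y - S x) & nrm x <= C * nrm y]).
Context (dist : forall x h, H h ->
  exists2 h', H h' & nrm (x - h') <= C * nrm (S x - h)).
Let r : R := (4 * C)^-1.

Let small v : cabs v <= r -> 4 * (C * cabs v) <= 1.
Proof.
by rewrite /r -[_^-1]mul1r ler_pdivlMr ?mulr_gt0// mulrC mulrA.
Qed.

(** A lift for [S] is an approximate lift for [S - v], with remainder [v *: x]. *)
Lemma core_lift v y : cabs v <= r -> H y ->
  exists x, [/\ H x, M (y - shift_op S v x) & nrm x <= 2 * C * nrm y].
Proof.
move=> /small vr.
apply: (exact_lift_of_approximate (bdd_by_shift v Sb) clH lH clM lM (ltW C0)).
move=> {}y Hy; have [x [Hx Mx nx]] := lift Hy.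
exists x, (y - S x).
have -> : y - shift_op S v x - (y - S x) = v *: x.
  by rewrite shift_opE !opprB [y + _]addrA subrKA addrAC subrr add0r.
split=> //; first exact: (linsubZ lH).
rewrite nrmZ.
have := ler_wpM2l (cabs_ge0 v) nx; have := ler_wpM2r (nrm_ge0 y) vr.
have := nrm_ge0 y; lra.
Qed.

(** For [x - p] nearly orthogonal to [H] in the sense of [near_best_approximation],
    the term [v *: (x - p)] is absorbed by the distance from [x] to [H]. *)
Lemma core_dist v x h : cabs v <= r -> H h ->
  exists2 h', H h' & nrm (x - h') <= 4 * C * nrm (shift_op S v x - h).
Proof.
move=> /small vr Hh; have [p Hp best] := near_best_approximation x clH lH.
have Hh2 : H (h - shift_op S v p) by apply: (linsubB lH) => //; exact: core_shift.
have [h' Hh' nh] := dist (x - p) Hh2.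
exists p => //; have := best (p + h') (linsubD lH Hp Hh').
rewrite opprD addrA; set N := nrm (shift_op S v x - h); set e := nrm (x - p).
have : nrm (S (x - p) - (h - shift_op S v p)) <= N + cabs v * e.
  rewrite /N /e -nrmZ (le_trans _ (nrmD _ _))//.
  have -> : S (x - p) = shift_op S v (x - p) + v *: (x - p) by rewrite subrK.
  rewrite [shift_op S v (x - p)]linearB [- (h - _)]opprB.
  by rewrite [_ - _ + v *: _]addrAC subrKA addrAC.
have e0 : 0 <= e by exact: nrm_ge0.
move=> /(ler_wpM2l (ltW C0)); have := ler_wpM2r e0 vr.
by move: nh; lra.
Qed.

Lemma sum_range_lift v z : cabs v <= r -> sum_range v z ->
  exists x, [/\ [set: X] x, H (z - shift_op S v x) & nrm x <= 4 * C * nrm z].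
Proof.
move=> vr [x _ Hx]; have [h' Hh' nh] := core_dist x vr (linsubN lH Hx).
exists (x - h'); split=> //.
  rewrite [shift_op S v (x - h')]linearB opprD opprK addrA.
  by apply: (linsubD lH) => //; exact: core_shift.
by move: nh; rewrite opprK [shift_op S v x + _]addrC subrK.
Qed.

Lemma closed_sum_range v : cabs v <= r -> closed (sum_range v).
Proof.
move=> vr; apply: (closed_of_exact_lift (bdd_by_shift v Sb) _ _ clH lH) => //.
by move=> z; exact: sum_range_lift.
Qed.

Lemma linsub_sum_range v : linsub (sum_range v).
Proof. exact: linsub_image_plus. Qed.

Lemma sum_range_gap v v' y : cabs v <= r -> sum_range v y ->
  exists2 p, sum_range v' p & nrm (y - p) <= 4 * C * cabs (v - v') * nrm y.
Proof.
move=> vr /(sum_range_lift vr)[x [_ Hx nx]].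
exists (shift_op S v' x + (y - shift_op S v x)).
  by exists x => //; rewrite addrAC subrr add0r.
have -> : y - (shift_op S v' x + (y - shift_op S v x)) = (v' - v) *: x.
  by rewrite -(shift_op_sub S) opprD addrCA subKr addrC.
by rewrite nrmZ cabs_dist [leRHS]mulrAC mulrC ler_wpM2r ?cabs_ge0.
Qed.

Lemma preimage_gap v v' x : cabs v' <= r -> K v x ->
  exists2 x', K v' x' & nrm (x - x') <= 2 * C * cabs (v - v') * nrm x.
Proof.
move=> vr Kx; have Hx := shift_preimage_sub_core tud Kx.
have [u [Hu Mu nu]] := core_lift vr (linsubZ lH (v - v') Hx).
exists (x - u); last by rewrite subKr; rewrite nrmZ mulrA in nu.
rewrite /shift_preimage /mkset linearB.
by have := linsubD lM Kx Mu; rewrite -(shift_op_sub S) addrA subrKC.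
Qed.

Lemma indep_preimage_const v m : cabs v <= r ->
  indep (K 0) M m <-> indep (K v) M m.
Proof.
have [e e0 eP] := indep_perturb_numerator X m.
have s0 : 0 < e / (2 * C) by rewrite divr_gt0// mulr_gt0.
apply: (disk_chain (Q := fun v => indep (K v) M m) s0) => a a' ar a'r aa'.
apply: eP => //; [exact: linsub_shift_preimage|exact: iter_kernel_sub_preimage|].
move=> x /(preimage_gap a'r)[x' Kx' nx]; exists x' => //.
rewrite (le_trans nx)// ler_wpM2r ?nrm_ge0//.
by rewrite mulrC -ler_pdivlMr// mulr_gt0.
Qed.

Lemma indep_sum_range_const v m : cabs v <= r ->
  indep [set: X] (sum_range 0) m <-> indep [set: X] (sum_range v) m.
Proof.
have [e e0 eP] := indep_perturb_denominator X m.
have s0 : 0 < e / (4 * C) by rewrite divr_gt0// mulr_gt0.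
apply: (disk_chain (Q := fun v => indep _ (sum_range v) m) s0) => a a' ar a'r aa'.
apply: eP; [exact: closed_sum_range|exact: linsub_sum_range|].
move=> y /(sum_range_gap a a'r)[p Rp np]; exists p => //.
rewrite (le_trans np)// ler_wpM2r ?nrm_ge0//.
by rewrite mulrC -ler_pdivlMr ?mulr_gt0// cabs_dist.
Qed.

(** [core_lift] solves the equation modulo [M], and [S - v] maps [M] onto [M]. *)
Lemma core_shift_surj v y : cabs v <= r -> v != 0 -> H y ->
  exists2 x, H x & y = shift_op S v x.
Proof.
move=> vr v0 Hy; have [x [Hx Mx _]] := core_lift vr Hy.
have [u Mu xu] := iter_kernel_shift_surj v0 Mx.
exists (x + u); first by apply: (linsubD lH) => //; exact: iter_kernel_sub_core.
by rewrite linearD -xu addrC subrK.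
Qed.

Lemma core_sub_range v n : cabs v <= r -> v != 0 ->
  H `<=` range_pow (shift_op S v) n.
Proof.
move=> vr v0; elim: n => [|n IH] y Hy; first by rewrite range0.
have [x Hx ->] := core_shift_surj vr v0 Hy.
by apply: range_step; exact: IH.
Qed.

Lemma sum_rangeE v : cabs v <= r -> v != 0 ->
  sum_range v = range_pow (shift_op S v) 1.
Proof.
move=> vr v0; apply/seteqP; split=> y; last first.
  by move=> [x _ <-]; exists x => //; rewrite subrr; exact: (linsub0 lH).
move=> [x _ Hx]; apply: (linsubBl (y := shift_op S v x)).
- exact: linsub_range.
- exact: core_sub_range Hx.
- by exists x.
Qed.

Lemma punctured_disk v : cabs v <= r -> v != 0 ->
  [/\ closed (range_pow (shift_op S v) 1),
    forall n, alpha_on (range_pow (shift_op S v) n) (shift_op S v) =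
      alpha_on (range_pow S d) S &
    beta_on (range_pow (shift_op S v) 0) (shift_op S v) =
      beta_on (range_pow S d) S].
Proof.
move=> vr v0; split.
- by rewrite -sum_rangeE//; exact: closed_sum_range.
- move=> n; have -> : alpha_on (range_pow (shift_op S v) n) (shift_op S v) =
      alpha_on (range_pow (shift_op S v) 0) (shift_op S v).
    congr vdim; apply/seteqP; split=> x [Rx Nx]; split=> //.
      by rewrite range0.
    apply: core_sub_range => //; apply: (shift_preimage_sub_core tud (v := v)).
    by rewrite /shift_preimage /mkset Nx; exact: (linsub0 lM).
  rewrite -(alpha_preimage S d v0) -(alpha_preimage0 S d).
  by apply: quot_dim_eq => // m; apply: iff_sym; exact: indep_preimage_const.
- rewrite beta_onE range0 -sum_rangeE// -(beta_image_plus0 S d).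
  apply: quot_dim_eq; [exact: linsub_sum_range|exact: linsub_sum_range|].
  by move=> m; apply: iff_sym; exact: indep_sum_range_const.
Qed.

End Disk.

(** The equality of nullities for every [n] also records that the null space of
    [S - v] is contained in all the ranges of its powers. *)
Theorem punctured_neighbourhood : exists2 r : R, 0 < r &
  forall v, cabs v <= r -> v != 0 ->
  [/\ closed (range_pow (shift_op S v) 1),
    forall n, alpha_on (range_pow (shift_op S v) n) (shift_op S v) =
      alpha_on (range_pow S d) S &
    beta_on (range_pow (shift_op S v) 0) (shift_op S v) =
      beta_on (range_pow S d) S].
Proof.
have [C C0 [lift dist]] := core_constant.
exists (4 * C)^-1; first by rewrite invr_gt0 mulr_gt0.
exact: punctured_disk.
Qed.

End PuncturedDisk.

(** * Closedness of the ranges *)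
Section FiniteKernel.
Context (R : realType) (X : completeNormedModType R[i]).
Implicit Types (A P : set X) (x y z : X).

Lemma indep_add_line A P x m : linsub P -> A x -> ~ P x ->
  indep A (add_line P x) m -> indep A P m.+1.
Proof.
move=> lP Ax nPx [e [Ae inde]].
exists (fun i => if unlift ord0 i is Some j then e j else x); split.
  by move=> i; case: unliftP.
move=> c; rewrite big_ord_recl unlift_none.
under eq_bigr do rewrite liftK.
move=> Pc; have c0 i : c (lift ord0 i) = 0.
  apply: (inde (fun i => c (lift ord0 i))); exists (- c ord0).
  by rewrite scaleNr opprK addrC.
move: Pc; rewrite big1 => [|i _]; last by rewrite c0 scale0r.
rewrite addr0 => Pc i; case: (unliftP ord0 i) => [j ->|->]; first exact: c0.
apply: contra_notP nPx => /eqP cn0.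
by have := linsubZ lP (c ord0)^-1 Pc; rewrite scalerA mulVf// scale1r.
Qed.

(** Adding a line to a closed subspace keeps it closed, and lowers the codimension
    of [P] in [A]. *)
Lemma closed_finite_extension A P m : linsub A -> closed P -> linsub P ->
  P `<=` A -> ~ indep A P m -> closed A.
Proof.
move=> lA; elim: m P => [|m IH] P clP lP PA; first by move/(_ (indep0 A P)).
have [AP _|/existsNP[x /not_implyP[Ax nPx]] nind] := pselect (A `<=` P).
  by have -> : A = P by apply/seteqP.
apply: (IH (add_line P x)).
- exact: closed_add_line.
- exact: linsub_add_line.
- by move=> y [c Py]; apply: (linsubBl lA (PA _ Py)); exact: (linsubZ lA).
- by move/(indep_add_line lP Ax nPx).
Qed.

Context (S : {linear X -> X}) (b : R) (Sb : bdd_by S b).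
Context (d : nat) (tud : TUD S d).
Hypothesis alpha_fin : (alpha_on (range_pow S d) S < +oo)%E.

(** [S] maps the null space of [S^(j+1)] in [R(S^d)] into that of [S^j], with
    kernel [R(S^d) meet N(S)]. *)
Lemma iter_kernel_range_finite j :
  (quot_dim (range_pow S d `&` iter_kernel S j) [set (0 : X)%R] < +oo)%E.
Proof.
have lR := linsub_range S d; have l0 := linsub_0 X; have lN := linsub_null S.
have lF i : linsub (range_pow S d `&` iter_kernel S i).
  by apply: linsubI => //; exact: linsub_iter_kernel.
elim: j => [|j IH].
  apply: (@quot_dim_lty _ _ _ _ 1) => //; rewrite /iter_kernel => -[e [Fe inde]].
  have := inde (fun=> 1); rewrite big_ord_recl big_ord0 scale1r addr0.
  move=> /(_ (Fe ord0).2 ord0)/eqP; by rewrite oner_eq0.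
rewrite (quot_dimD (B := range_pow S d `&` null_space S))//.
- rewrite lte_add_pinfty//; apply: le_lt_trans IH; apply: quot_dim_le => //.
    exact: linsubI.
  move=> n; apply: (indep_image (phi := S)) => //.
    move=> x [Rx Sx]; split; last by rewrite /iter_kernel /mkset lin_iterS.
    by apply: (range_leq (leqnSn d)); exact: range_step.
  by move=> x [Rx _] Sx.
- exact: linsubI.
- by move=> x [Rx Nx]; split=> //; rewrite /iter_kernel /mkset -lin_iterS Nx linear0.
- by move=> x ->; apply: linsub0; exact: linsubI.
Qed.

(** [R(S^n) + M] is closed by the hypothesis on operator range topologies, and
    [R(S^n) meet M] is finite-dimensional. Two operator ranges with closed sum
    and closed intersection are closed. *)
Lemma closed_range n : (d <= n)%N -> closed (range_pow S n).
Proof.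
move=> dn; pose M := iter_kernel S d.
have lM : linsub M by exact: linsub_iter_kernel.
have clM : closed M by exact: closed_iter_kernel Sb.
have lR := linsub_range S n.
have [b' Sb'] := bdd_by_iter n Sb; have [c c0 Sc] := bdd_by_ge0 Sb'.
have clF : closed (range_pow S n `&` M).
  have := iter_kernel_range_finite d.
  case: (quot_dimP _ (linsub_0 X)) => // m e eb indF _.
  apply: (@closed_finite_extension _ [set 0] m.+1).
  - exact: linsubI.
  - apply/closed_nrmP => x x0; apply: contrapT => /eqP; rewrite -nrm_gt0 => xpos.
    by have [y ->] := x0 _ xpos; rewrite subr0 ltxx.
  - exact: linsub_0.
  - by move=> x ->; apply: linsub0; exact: linsubI.
  - move=> indRM; suff /indF : indep (range_pow S d `&` M) [set 0] m.+1.
      by rewrite ltnn.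
    apply: (indep_image (phi := idfun)) indRM => //; first exact: linsubI.
    by move=> x [/(range_leq dn) Rx Mx].
have clZ : closed (image_plus (lin_iter S n) [set: X] M).
  have -> : image_plus (lin_iter S n) [set: X] M =
      [set x | range_pow S (d + n) (lin_iter S d x)].
    apply/seteqP; split=> [x [y _ Mx]|x [y _ Sx]].
      exists y => //; rewrite iterD; apply/esym/eqP; rewrite -subr_eq0.
      by apply/eqP; rewrite -[RHS]Mx linearB.
    exists y => //; apply/eqP; rewrite linearB subr_eq0; apply/eqP.
    exact: etrans (esym Sx) (iterD _ _ _ _).
  by apply: closed_preimage_range => //; exact: leq_addr.
have [C C0 lift] := exact_lift_of_closed Sb' (@closedT X) (linsubT X) clM lM clZ.
apply/closed_nrmP => z zR.
have Zz : image_plus (lin_iter S n) [set: X] M z.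
  move/closed_nrmP: clZ; apply=> e /zR[_ [x _ <-] zx]; exists (lin_iter S n x) => //.
  by exists x => //; rewrite subrr; exact: (linsub0 lM).
(* Lifting [z - y] for a point [y] of the range close to [z] shows that [z] is
   congruent, modulo the range, to arbitrarily small elements of [M]. *)
have near e : 0 < e -> exists2 m, M m & range_pow S n (z - m) /\ nrm m < e.
  move=> e0; have c1 : 0 < 1 + c * C by rewrite ltr_wpDr// mulr_ge0.
  have [y Ry zy] := zR (e / (1 + c * C)) (divr_gt0 e0 c1).
  have [|x [_ Mx nx]] := lift (z - y).
    apply: linsubB => //; first exact: linsub_image_plus.
    case: Ry => x _ <-; exists x => //; rewrite subrr; exact: (linsub0 lM).
  exists (z - y - lin_iter S n x) => //; split.
    by rewrite opprB addrCA subKr; apply: linsubD => //; exact: range_iter.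
  rewrite ltr_pdivlMr// mulrC in zy; apply: le_lt_trans zy.
  rewrite (le_trans (nrmB _ _))// mulrDl mul1r lerD2l (le_trans (Sc _))//.
  by rewrite -mulrA ler_wpM2l.
(* All these elements are congruent modulo the closed space [R(S^n) meet M], and
   they accumulate at [0]; so they belong to it. *)
have [m0 Mm0 [Rm0 _]] := near 1 ltr01.
suff [Rm _] : (range_pow S n `&` M) m0 by exact: linsubBl Rm0 Rm.
move/closed_nrmP: clF; apply=> e /near[m Mm [Rm nm]].
exists (m0 - m); last by rewrite subKr.
split; last exact: linsubB.
by have := linsubB lR Rm Rm0; rewrite opprB addrC subrKA addrC.
Qed.

End FiniteKernel.

(** * The equivalence *)
Section Equivalence.
Context (R : realType) (X : completeNormedModType R[i]).
Context (S : {linear X -> X}) (b : R) (Sb : bdd_by S b).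
Context (d : nat) (tud : TUD S d).

Lemma upper_semi_B_Weyl_of_desc : (alpha_on (range_pow S d) S < +oo)%E ->
  (alpha_on (range_pow S d) S <= beta_on (range_pow S d) S)%E ->
  upper_semi_B_Weyl S.
Proof.
move=> afin ab; apply/upper_semi_B_WeylP; exists d => //; split.
  by have := closed_range Sb tud afin (leqnn d).
split=> //; apply: closed_subspace_range.
by have := closed_range Sb tud afin (leqnSn d).
Qed.

(** The exponent [n] at which [S] is upper semi-B-Fredholm may lie on either side of
    [d]. From [d] on, the nullities are equal; before [d], they can only decrease. *)
Lemma upper_semi_B_Weyl_desc : upper_semi_B_Weyl S ->
  (alpha_on (range_pow S d) S < +oo)%E /\
  (alpha_on (range_pow S d) S <= beta_on (range_pow S d) S)%E.
Proof.
move=> /upper_semi_B_WeylP[n [_ [an _]] ab].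
have ad : (alpha_on (range_pow S d) S < +oo)%E.
  have [dn|/ltnW nd] := leqP d n; last by have [] := alpha_le_beta_leq nd an.
  rewrite (_ : alpha_on _ _ = alpha_on (range_pow S n) S)//.
  congr vdim; apply/seteqP; split=> x [Rx Nx]; split=> //.
    exact: (null_range tud).
  exact: range_leq Rx.
split=> //; have [dn|/ltnW nd] := leqP d n.
  by rewrite (alpha_le_beta_leq dn ad).2.
by rewrite -(alpha_le_beta_leq nd an).2.
Qed.

Lemma punctured_Weyl : exists2 r : R, 0 < r & forall v, cabs v <= r -> v != 0 ->
  (upper_semi_B_Weyl S -> upper_semi_Weyl (shift_op S v)) /\
  (upper_semi_B_Weyl (shift_op S v) -> upper_semi_B_Weyl S).
Proof.
have [r r0 disk] := punctured_neighbourhood Sb tud.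
exists r => // v vr v0; have [cl aE bE] := disk v vr v0; split.
  move=> /upper_semi_B_Weyl_desc[afin ab].
  by apply/upper_semi_WeylP; rewrite aE bE.
move=> /upper_semi_B_WeylP[n [_ [an _]]].
have a0 : (alpha_on (range_pow (shift_op S v) 0) (shift_op S v) < +oo)%E.
  by rewrite aE -(aE n).
rewrite -(alpha_le_beta_leq (leq0n n) a0).2 aE bE => ab.
by apply: upper_semi_B_Weyl_of_desc => //; rewrite -(aE n).
Qed.

End Equivalence.

Section ComplexPlane.
Context (R : realType).
Implicit Types (A : set (R[i] : numFieldType)) (z : R[i]).

Lemma nbhs_cabsP z A : nbhs (z : R[i] : numFieldType) A <->
  exists2 e : R, 0 < e & forall v, cabs v < e -> A (z + v).
Proof.
split=> [/nbhs_normP[e /= e0 eA]|[e e0 eA]].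
  have eE : e = (complex.Re e)%:C%C by rewrite RRe_real// gtr0_real.
  exists (complex.Re e) => [|v ve]; first by rewrite -ltcR -eE.
  by apply: eA; rewrite /= eE cabsE ltcR opprD addrA subrr add0r normcN.
apply/nbhs_normP; exists e%:C%C; first by rewrite /= ltcR.
move=> w /=; rewrite cabsE ltcR cabs_dist => /eA.
by rewrite addrC subrK.
Qed.

Lemma limit_point_interior z A : A° z -> limit_point A z.
Proof.
move=> Az U Uz.
have AUz : nbhs (z : R[i] : numFieldType) (A `&` U) by exact: filterI.
have [e e0 eP] := (nbhs_cabsP _ _).1 AUz.
have e2 : 0 < e / 2 by rewrite divr_gt0.
have [|Aw Uw] := eP (e / 2)%:C%C.
  by rewrite cabs_real gtr0_norm// ltr_pdivrMr// ltr_pMr// ltr1n.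
exists (z + (e / 2)%:C%C); split=> //.
by rewrite -subr_eq0 addrAC subrr add0r -cabs_eq0 cabs_real normr_eq0 gt_eqF.
Qed.

Lemma bounded_nearP (X : normedModType R[i]) (T : {linear X -> X}) :
  bounded_near T (nbhs (0 : X)) -> exists b : R, bdd_by T b.
Proof.
move=> /linear_boundedP/pinfty_ex_gt0[c c0 Tc]; exists (complex.Re c) => x.
have cE : c = (complex.Re c)%:C%C by rewrite RRe_real// gtr0_real.
by have := Tc x; rewrite !normE {1}cE -rmorphM/= lecR.
Qed.

End ComplexPlane.

Theorem theorem2p3 (R : realType) (X : completeNormedModType R[i])
  (X_infinite_dim : vdim [set: X] = +oo%E)
  (lambda : R[i]) (T : {linear X -> X}) (T_bounded : bounded_near T (nbhs (0 : X)))
  (d : nat) (T_TUD : TUD (shift_op T lambda) d) :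
  [<-> ~ limit_point (spectrum_W T) lambda;
       ~ (spectrum_W T)° lambda;
       ~ limit_point (spectrum_BW T) lambda;
       ~ (spectrum_BW T)° lambda;
       upper_semi_B_Weyl (shift_op T lambda)].
Proof.
set S := shift_op T lambda.
have [c Tc] := bounded_nearP T_bounded.
have [r r0 disk] := punctured_Weyl (bdd_by_shift lambda Tc) T_TUD.
have WB : spectrum_BW T `<=` spectrum_W T.
  by move=> mu nBW W; apply: nBW; exact: upper_semi_B_Weyl_of_Weyl.
have shiftS v : shift_op T (lambda + v) = shift_op S v by rewrite shift_op_add.
have P12 : ~ limit_point (spectrum_W T) lambda -> ~ (spectrum_W T)° lambda.
  by apply: contra_not; exact: limit_point_interior.
have P24 : ~ (spectrum_W T)° lambda -> ~ (spectrum_BW T)° lambda.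
  by apply: contra_not => /(interiorS WB).
have P45 : ~ (spectrum_BW T)° lambda -> upper_semi_B_Weyl S.
  apply: contra_notP => nBW; apply/nbhs_cabsP; exists r => // v vr.
  rewrite /spectrum_BW /mkset shiftS; have [->|v0] := eqVneq v 0.
    by rewrite shift_op0.
  by move/(disk v (ltW vr) v0).2.
have P51 : upper_semi_B_Weyl S -> ~ limit_point (spectrum_W T) lambda.
  move=> BW /(_ [set mu | cabs (mu - lambda) < r])[].
    by apply/nbhs_cabsP; exists r => // v; rewrite /mkset addrAC subrr add0r.
  move=> mu [mu_neq /[swap] mu_r]; apply.
  rewrite -(subrKC lambda mu) shiftS.
  by apply: (disk _ (ltW mu_r) _).1 => //; rewrite subr_eq0.
have P13 : ~ limit_point (spectrum_W T) lambda -> ~ limit_point (spectrum_BW T) lambda.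
  apply: contra_not => lim U /lim[mu [mu_neq BWmu Umu]].
  by exists mu; split=> //; exact: WB.
have P34 : ~ limit_point (spectrum_BW T) lambda -> ~ (spectrum_BW T)° lambda.
  by apply: contra_not; exact: limit_point_interior.
tfae => //.
by move=> /P24/P45/P51/P13.
Qed.
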